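(* Let $N>400$ be an integer and suppose that the optimal permutation is of the form $\pi_k$ for some $k$ (that is, the maximum of $E$ over $S_N$ is attained at some $\pi_k$). Then the optimal number $k^*(N)$ of tricks to throw satisfies $$\sqrt{\frac{N\ln N}{4}}<k^*(N)<\sqrt{\frac{N\ln N}{2}}.$$ Moreover, unconditionally, as $N\to\infty$ one has $k^*(N)\sim\sqrt{N\ln N/2}$ (where $k^*(N)$ is defined for all sufficiently large $N$), i.e. $k^*(N)/\sqrt{N\ln N/2}\to 1$.
   Context: A deck of $2N$ cards with face values $1,\dots,2N$ is shuffled uniformly at random and dealt so that each of two players gets $N$ cards. Let $a_1<\dots<a_N$ be player 2's cards and $b_1<\dots<b_N$ player 1's cards. A strategy for player 2 is a permutation $\pi\in S_N$: card $a_i$ is played against $b_{\pi(i)}$ and wins that trick iff $a_i>b_{\pi(i)}$. $E(\pi)=\sum_{i=1}^N \Pr(a_i>b_{\pi(i)})$ is the expected number of tricks won by player 2; a permutation is optimal if it maximizes $E$ over $S_N$. For $0\le k\le N$, $\pi_k\in S_N$ is given by $\pi_k(i)=N+1-i$ for $1\le i\le k$ and $\pi_k(i)=i-k$ for $k<i\le N$ (it ''throws'' $k$ tricks). When some $\pi_k$ is optimal, $k^*(N)$ denotes the optimal number of tricks to throw, i.e. the largest $k$ such that $\pi_k$ is optimal. *)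

(* Defs.v *)
From mathcomp Require Import all_boot all_order all_fingroup all_algebra.
From mathcomp Require Import all_classical all_reals all_analysis.

Set Implicit Arguments.
Unset Strict Implicit.
Unset Printing Implicit Defensive.

Import Order.TTheory GRing.Theory Num.Theory.
Import numFieldNormedType.Exports.

Local Open Scope ring_scope.

(* The card with face value v, for 1 <= v <= 2N, is the element v - 1 of
   'I_(2 * N).  A shuffle s puts card s p at position p of the deck; player 2
   is dealt the first N positions and player 1 the last N. *)
Definition hand1 (N : nat) (s : 'S_(2 * N)) : {set 'I_(2 * N)} :=
  [set s p | p : 'I_(2 * N) & (N <= p)%N].

Definition hand2 (N : nat) (s : 'S_(2 * N)) : {set 'I_(2 * N)} :=
  [set s p | p : 'I_(2 * N) & (p < N)%N].

Definition sorted_values (n : nat) (H : {set 'I_n}) : seq nat :=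
  sort leq [seq (val c).+1 | c <- enum H].

(* Indices are 0-based: b_card s i and a_card s i are the face values written
   b_(i+1) and a_(i+1) with 1-based indices. *)
Definition b_card (N : nat) (s : 'S_(2 * N)) (i : 'I_N) : nat :=
  nth 0%N (sorted_values (hand1 s)) i.

Definition a_card (N : nat) (s : 'S_(2 * N)) (i : 'I_N) : nat :=
  nth 0%N (sorted_values (hand2 s)) i.

Section Expectation.
Variable R : realType.

Definition shuffle_prob (N : nat) (e : pred 'S_(2 * N)) : R :=
  #|[set s : 'S_(2 * N) | e s]|%:R / #|[set: 'S_(2 * N)]|%:R.

Definition expected_tricks (N : nat) (pi : 'S_N) : R :=
  \sum_(i < N) shuffle_prob (fun s => (b_card s (pi i) < a_card s i)%N).

Definition optimal (N : nat) (pi : 'S_N) : bool :=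
  [forall sigma : 'S_N, expected_tricks sigma <= expected_tricks pi].

End Expectation.

Lemma throw_subproof (N k : nat) (i : 'I_N) : (i - k < N)%N.
Proof. exact: leq_ltn_trans (leq_subr k i) (ltn_ord i). Qed.

(* In 0-based indices: i |-> N - 1 - i for i < k, and i |-> i - k for i >= k. *)
Definition throw_fun (N k : nat) (i : 'I_N) : 'I_N :=
  if (i < k)%N then rev_ord i else Ordinal (throw_subproof k i).

Lemma throw_fun_inj (N k : nat) : injective (@throw_fun N k).
Proof.
have aux (i j : 'I_N) : (i < k)%N -> (k <= j)%N -> (N - i.+1)%N <> (j - k)%N.
  move=> ik kj eq_ij; have := ltn_ord j.
  rewrite -(subnK kj) -eq_ij ltnNge => /negP; apply.
  rewrite -[leqLHS](subnK (ltn_ord i)) leq_add2l.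
  exact: ik.
move=> i j; rewrite /throw_fun; case: ltnP => ik; case: ltnP => jk.
- exact: rev_ord_inj.
- by move=> /(congr1 val) /= /(aux _ _ ik jk).
- by move=> /(congr1 val) /= /esym /(aux _ _ jk ik).
- move=> /(congr1 val) /= eq_ij; apply/val_inj => /=.
  by rewrite -(subnK ik) -(subnK jk) eq_ij.
Qed.

Definition throw (N k : nat) : 'S_N := perm (@throw_fun_inj N k).

(* The largest k <= N such that [throw N k] is optimal; the value is the junk
   value 0 if there is no such k. *)
Definition kstar (R : realType) (N : nat) : nat :=
  \max_(k < N.+1 | optimal R (throw N k)) k.

(* Main.v *)
(* Let [p i j] be the probability that [a_i] beats [b_j] and [q s j] its increment
   in [s], the probability that [b_j] falls between [a_s] and [a_(s+1)].  The
   function [q s] is unimodal with peak at [j = s] and [j = s + 1], and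
   [p i j + p j i = 1].  Hence exchanging two cards shows that in an optimal
   permutation the throwers ([i < pi i]) are decreasing and the winners
   ([pi i <= i]) increasing.
   Throwing one more card changes the expectation of [throw N k] by [U k - 1] up to
   a small term, where [U k] is the expected number of steps from level [k + 1] down
   to level [k] of the walk that goes up on player 2's cards and down on player 1's.
   By reflection [U k] is the tail [sum_(j < N - k) C(2N, j) / C(2N, N)], and Mills
   ratio estimates locate the point where it crosses [1].
   For a general optimal permutation with [k] throwers one still has [U k <= 1], so
   [k] is at least about [sqrt (N ln N / 2)].  If the throwers are not the first [k]
   positions (or, after turning the deck upside down, their values not the last
   [k] ones), the last throw is between nearby cards; the winners it helps are then
   too few to pay for it. *)
Require Import Defs.
From mathcomp Require Import all_boot all_order all_fingroup all_algebra.
From mathcomp Require Import all_classical all_reals all_analysis.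
From mathcomp Require Import zify ring lra.

Set Implicit Arguments.
Unset Strict Implicit.
Unset Printing Implicit Defensive.

Import Order.TTheory GRing.Theory Num.Theory.
Import numFieldNormedType.Exports.

(** Heuristically, for [k^2 = c N ln N] the tail is about [(N / 2k) exp (- k^2 / N) = N^(1/2 - c) /
    (2 sqrt (c ln N))], so it drops from large to small near [c = 1/2]; this is the origin of
    [sqrt (N ln N / 2)]. Undoing the last of [k] throws is compared with a winning probability known
    only to be at most 1/2, hence optimality yields [U k <= 1] but merely [1 <= 2 U (k - 1)]. The
    lost factor 2 is harmless: at [c = 1/2] the tail is about [1 / sqrt (2 ln N)], already below 1/2
    for [N > 400]. At [c = 1/4] the tail is of order [N^(1/4)] up to logarithms, which leaves room
    to start at 401. The values of a general optimal permutation are unknown, but their ranks are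
    not: a winner's value is at least the number of winners before it. Since [q s] increases up to
    [s], replacing a value by its rank bound changes each sum in the required direction, and the
    unknown sums become the tail [U]. Probabilities are multiplied by ['C(2 * N, N)] and handled as
    natural numbers until the analytic estimates. *)

(** * From shuffles to hands: winning probabilities as sums of binomials *)

Lemma count_ltn_sorted_nth (s : seq nat) (v i : nat) :
  sorted leq s -> i < size s -> (nth 0 s i < v) = (i < count (fun x => x < v) s).
Proof.
move=> s_sorted i_lt.
case: (ltnP i (count _ s)) => h.
  exact: (nth_count_lt 0 s_sorted h).
apply/negbTE; rewrite -leqNgt.
by apply: (nth_count_ge (x := v) 0 s_sorted); rewrite i_lt andbT.
Qed.

Lemma sorted_values_lt (n i v : nat) (H : {set 'I_n}) :
  i < #|H| ->
  (nth 0 (sorted_values H) i < v.+1) = (i < #|[set c in H | c < v]|).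
Proof.
move=> iH; rewrite count_ltn_sorted_nth.
- congr (_ < _); rewrite count_sort count_map cardE -size_filter.
  apply/perm_size/uniq_perm.
  + by apply: filter_uniq; apply: enum_uniq.
  + by apply: enum_uniq.
  move=> c.
  by rewrite mem_filter !mem_enum [RHS]inE /= ltnS andbC.
- exact: (sort_sorted leq_total).
- by rewrite size_sort size_map -cardE.
Qed.

Lemma card_ord_lt (n v : nat) : v <= n -> #|[set c : 'I_n | c < v]| = v.
Proof.
by move=> vn; rewrite -sum1dep_card -(big_ord_widen n (fun=> 1) vn) sum1_card card_ord.
Qed.

Lemma card_hand2 (N : nat) (s : 'S_(2 * N)) : #|hand2 s| = N.
Proof.
rewrite card_imset; last exact: perm_inj.
by rewrite -[RHS](@card_ord_lt (2 * N) N) ?leq_pmull // cardsE; apply: eq_card.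
Qed.

Lemma hand1E (N : nat) (s : 'S_(2 * N)) : hand1 s = ~: hand2 s.
Proof.
apply/finset.setP => c; rewrite inE -[c](permKV s) !(mem_imset _ _ (@perm_inj _ s)).
by rewrite !inE leqNgt.
Qed.

Lemma card_hand1 (N : nat) (s : 'S_(2 * N)) : #|hand1 s| = N.
Proof. by rewrite hand1E cardsCs finset.setCK card_ord card_hand2 mul2n -addnn addnK. Qed.

(* Among the [i + j + 1] smallest cards, player 2 holds at most [i] iff
   player 1 holds at least [j + 1]. *)
Lemma lt_cards (N : nat) (s : 'S_(2 * N)) (i j : 'I_N) :
  (b_card s j < a_card s i) =
  (#|[set c in hand2 s | c < i + j + 1]| <= i).
Proof.
set m := i + j + 1; set al := #|_|.
have mN : m <= 2 * N by have := ltn_ord i; have := ltn_ord j; rewrite /m; lia.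
pose be := #|[set c in hand1 s | c < m]|.
have abm : al + be = m.
  rewrite -[RHS](card_ord_lt mN) -(cardsID (hand2 s) [set c : 'I__ | c < m]).
  congr (_ + _); apply: eq_card => c; rewrite !inE ?hand1E ?inE; first exact: andbC.
  by [].
have := @sorted_values_lt _ i m (hand2 s);
  rewrite card_hand2 -/(a_card s i) -/al => /(_ (ltn_ord i)) ha.
have := @sorted_values_lt _ j m (hand1 s);
  rewrite card_hand1 -/(b_card s j) -/be => /(_ (ltn_ord j)) hb.
move: ha hb; rewrite /m in abm *; lia.
Qed.

Lemma card_sets_meeting (T : finType) (A : {set T}) (n t : nat) : t <= n ->
  #|[set H : {set T} | (#|H| == n) && (#|H :&: A| == t)]| =
  'C(#|A|, t) * 'C(#|~: A|, n - t).
Proof.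
move=> tn; rewrite -!cards_draws -cardsX.
set X := finset.setX _ _.
have fX (u : {set T} * {set T}) : u \in X ->
    ((u.1 :|: u.2) :&: A = u.1) /\ ((u.1 :|: u.2) :\: A = u.2).
  rewrite !inE => /andP[/andP[uA _] /andP[uC _]].
  rewrite finset.setIUl finset.setDUl (finset.setIidPl uA) (eqP (_ : u.1 :\: A == finset.set0))
    ?finset.setD_eq0 //.
  rewrite -finset.disjoints_subset in uC.
  have /eqP uA0 : u.2 :&: A == finset.set0 by rewrite finset.setI_eq0.
  by rewrite (finset.setDidPl uC) uA0 finset.set0U finset.setU0.
rewrite -[RHS](@card_in_imset _ _ (fun u => u.1 :|: u.2)); last first.
  move=> u v /fX[u1 u2] /fX[v1 v2] /= uv.
  by apply: injective_projections; [rewrite -u1 uv v1|rewrite -u2 uv v2].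
apply: eq_card => H; apply/idP/imsetP.
  rewrite inE => /andP[/eqP Hn /eqP Ht]; exists (H :&: A, H :\: A) => /=;
    last by rewrite finset.setID.
  rewrite !inE /= finset.subsetIr Ht eqxx /= finset.setDE finset.subsetIr -finset.setDE /=.
  by rewrite -Hn -(cardsID A H) Ht addKn.
move=> [u uX ->]; have [u1 u2] := fX _ uX.
rewrite inE u1 -(cardsID A (_ :|: _)) u1 u2.
move: uX; rewrite !inE => /andP[/andP[_ /eqP ->] /andP[_ /eqP ->]].
by rewrite subnKC // !eqxx.
Qed.

Lemma hand2_surj (N : nat) (H : {set 'I_(2 * N)}) :
  #|H| = N -> exists s : 'S_(2 * N), hand2 s = H.
Proof.
move=> HN; pose l := enum H ++ enum (~: H).
have sz : size l = 2 * N by rewrite size_cat -!cardE cardsC card_ord.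
have ul : uniq l.
  rewrite cat_uniq !enum_uniq andbT /=; apply/hasPn => c.
  by rewrite mem_enum inE => cH; rewrite /= mem_enum.
pose f (p : 'I_(2 * N)) := nth p l p.
have f_inj : injective f.
  move=> p p'; rewrite /f (set_nth_default p') ?sz // => /eqP.
  by rewrite nth_uniq ?sz // => /eqP /val_inj.
exists (perm f_inj); apply/eqP; rewrite finset.eqEcard card_hand2 HN leqnn andbT.
apply/fintype.subsetP => c /imsetP[p]; rewrite inE => pN ->.
rewrite permE /f nth_cat -cardE HN pN -mem_enum mem_nth // -cardE HN.
by [].
Qed.

(** Composing with a fixed permutation that carries [H] to [H'] is a bijection between the shuffles
    dealing them, so a uniform shuffle deals a uniform hand. *)
Lemma card_hand2_fiber (N : nat) (H H' : {set 'I_(2 * N)}) :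
  #|H| = N -> #|H'| = N ->
  #|[set s : 'S_(2 * N) | hand2 s == H]| = #|[set s : 'S_(2 * N) | hand2 s == H']|.
Proof.
have hand2M (s g : 'S_(2 * N)) : hand2 (s * g) = g @: hand2 s.
  by rewrite /hand2 -finset.imset_comp; apply: finset.eq_imset => p /=; rewrite permM.
move=> /hand2_surj[s sH] /hand2_surj[s' sH'].
pose g := (s^-1 * s')%g.
have gH : g @: H = H' by rewrite -sH -hand2M mulKVg.
rewrite -(card_imset _ (mulIg g)); apply: eq_card => u; rewrite inE.
apply/imsetP/eqP => [[v]|uH'].
  by rewrite inE => /eqP vH ->; rewrite hand2M vH.
exists (u * g^-1)%g; last by rewrite mulgKV.
by rewrite inE hand2M uH' -gH -finset.imset_comp -[X in _ == X]finset.imset_id;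
  apply/eqP/finset.eq_imset => c /=; rewrite permK.
Qed.

Lemma card_shuffles (N : nat) (e : pred {set 'I_(2 * N)}) (H0 : {set 'I_(2 * N)}) :
  #|H0| = N ->
  #|[set s : 'S_(2 * N) | e (hand2 s)]| =
  #|[set H : {set 'I_(2 * N)} | (#|H| == N) && e H]| * #|[set s : 'S_(2 * N) | hand2 s == H0]|.
Proof.
move=> H0N; rewrite -[LHS]sum1_card (eq_bigl (fun s => e (hand2 s))); last by move=> s;
  rewrite inE.
rewrite (partition_big (@hand2 N) (fun H => (#|H| == N) && e H)) /=; last first.
  by move=> s ->; rewrite card_hand2 eqxx.
rewrite -sum_nat_const big_set /=; apply: eq_bigr => H /andP[/eqP HN eH].
rewrite (card_hand2_fiber H0N HN) -sum1_card; apply: eq_bigl => s.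
by rewrite inE andbC; case: eqP => // ->.
Qed.

(* The number of deals with [b_(j+1) < a_(i+1)] (1-based cards): player 2 holds
   [t <= i] of the [i + j + 1] smallest cards. *)
Definition win_count (N i j : nat) : nat :=
  \sum_(t < i.+1) 'C(i + j + 1, t) * 'C(2 * N - (i + j + 1), N - t).

Lemma card_hands_win (N i j : nat) : i < N -> j < N ->
  #|[set H : {set 'I_(2 * N)} |
     (#|H| == N) && (#|[set c in H | c < i + j + 1]| <= i)]| = win_count N i j.
Proof.
move=> iN jN; set m := i + j + 1.
have mN : m <= 2 * N by rewrite /m; lia.
pose A := [set c : 'I_(2 * N) | c < m].
have cA : #|A| = m by exact: card_ord_lt.
have cCA : #|~: A| = 2 * N - m by rewrite cardsCs finset.setCK card_ord cA.
rewrite /win_count -/m -[LHS]sum1_card.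
rewrite (partition_big (fun H => inord #|H :&: A| : 'I_i.+1) xpredT) //=.
apply: eq_bigr => t _.
have tN : t <= N by have := ltn_ord t; lia.
rewrite -cCA -[in 'C(m, t)]cA -(card_sets_meeting A tN) -sum1_card; apply: eq_bigl => H;
  rewrite !inE -andbA; congr andb.
have -> : [set c in H | c < m] = H :&: A by apply/finset.setP => c; rewrite !inE.
apply/andP/eqP => [[le_i /eqP <-]|->]; first by rewrite inordK.
by rewrite -ltnS ltn_ord; split=> //; rewrite inord_val.
Qed.

Lemma expected_tricksE (R : realType) (N : nat) (pi : 'S_N) :
  expected_tricks R pi =
  (\sum_(i < N) (win_count N i (pi i))%:R / ('C(2 * N, N))%:R)%R.
Proof.
apply: eq_bigr => i _; rewrite /shuffle_prob.
have [H0 H0N] : exists H0 : {set 'I_(2 * N)}, #|H0| = N.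
  by exists (hand2 1); apply: card_hand2.
have c_gt0 : 0 < #|[set s : 'S_(2 * N) | hand2 s == H0]|.
  by have [s sH] := hand2_surj H0N; apply/card_gt0P; exists s; rewrite inE sH.
have shuffles_win : #|[set s : 'S_(2 * N) | b_card s (pi i) < a_card s i]| =
    win_count N i (pi i) * #|[set s : 'S_(2 * N) | hand2 s == H0]|.
  rewrite -card_hands_win // -card_shuffles //.
  by apply: eq_card => s; rewrite !inE lt_cards.
have all_shuffles : #|[set: 'S_(2 * N)]| =
    'C(2 * N, N) * #|[set s : 'S_(2 * N) | hand2 s == H0]|.
  rewrite -[in 'C(2 * N, N)](card_ord (2 * N)) -card_draws.
  rewrite -[X in _ = X * _](eq_card (_ : [set H : {set 'I_(2 * N)} | (#|H| == N) && predT H] =i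
    _)); last first.
    by move=> H; rewrite !inE andbT.
  by rewrite -card_shuffles //; apply: eq_card => s; rewrite !inE.
rewrite shuffles_win all_shuffles !natrM -mulf_div divff ?mulr1 //.
by rewrite pnatr_eq0 -lt0n.
Qed.

(** * Increments of the winning counts: symmetries and unimodality *)

(* The number of deals with [a_(s+1) < b_(j+1) < a_(s+2)] (1-based cards, no upper
   bound on [b_(j+1)] when [s + 1 = N]); see [win_countS]. *)
Definition gap_count (N s j : nat) : nat :=
  'C(s + j + 1, s.+1) * 'C((N - s.+1) + (N - j.+1), N - s.+1).

(** One more card is revealed: the counts differ by the deals in which player 2 holds exactly [i] of
    the [m] smallest cards and also the next one. *)
Lemma win_sum_pascal (N m i : nat) : i < N -> m < 2 * N ->
  \sum_(t < i.+1) 'C(m, t) * 'C(2 * N - m, N - t) =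
  \sum_(t < i.+1) 'C(m.+1, t) * 'C(2 * N - m.+1, N - t) +
  'C(m, i) * 'C(2 * N - m.+1, N - i.+1).
Proof.
move=> iN mN; have -> : 2 * N - m = (2 * N - m.+1).+1 by lia.
move: (2 * N - m.+1) => n; elim: i iN => [|i IH] iN.
  rewrite !big_ord1 !bin0 !mul1n subn0.
  by rewrite -(ltn_predK iN) binS subn1.
rewrite big_ord_recr IH /=; last by lia.
rewrite [in RHS]big_ord_recr /=.
have -> : N - i.+1 = (N - i.+2).+1 by lia.
by rewrite !binS; lia.
Qed.

Lemma win_countS (N s j : nat) : s < N -> j < N ->
  win_count N s.+1 j = win_count N s j + gap_count N s j.
Proof.
move=> sN jN; rewrite /win_count (win_sum_pascal (m := s + j + 1)) //; last by lia.
have -> : s.+1 + j + 1 = (s + j + 1).+1 by lia.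
rewrite big_ord_recr /= -!addnA; congr (_ + _).
rewrite /gap_count; have -> : N - s.+1 + (N - j.+1) = 2 * N - (s + j + 1).+1 by lia.
by rewrite !addnA binS mulnDl addnC.
Qed.

(** The difference counts the deals in which [a_i] beats [b_j] but not the next card of player 1;
    exchanging the players makes this a gap count with swapped indices. *)
Lemma win_countS_right (N i j : nat) : i < N -> j < N ->
  win_count N i j = win_count N i j.+1 + gap_count N j i.
Proof.
move=> iN jN; rewrite /win_count (win_sum_pascal (m := i + j + 1)) //; last by lia.
have -> : i + j.+1 + 1 = (i + j + 1).+1 by lia.
congr (_ + _); rewrite /gap_count.
have -> : N - j.+1 + (N - i.+1) = 2 * N - (i + j + 1).+1 by lia.
congr (_ * _); first by rewrite -bin_sub; [congr 'C(_, _)|]; lia.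
by rewrite -bin_sub; [congr 'C(_, _)|]; lia.
Qed.

(** Index [N] acts as a fictitious card above the whole deck, so the increment at [s = N - 1] needs
    no special case; [win_count_right] does the same for player 1. *)
Lemma win_count_top (N j : nat) : j < N -> win_count N N j = 'C(2 * N, N).
Proof. by move=> jN; rewrite /win_count binomial.Vandermonde; congr 'C(_, _); lia. Qed.

Lemma win_count_right (N i : nat) : i < N -> win_count N i N = 0.
Proof.
move=> iN; rewrite /win_count big1 // => t _.
by rewrite (@bin_small (2 * N - _)) ?muln0 //; have := ltn_ord t; lia.
Qed.

(** When [i] moves by one, the two terms change by the same gap count in opposite directions; the
    sum is therefore constant and is read off at the fictitious index [N]. *)
Lemma win_countC (N i j : nat) : i <= N -> j < N ->
  win_count N i j + win_count N j i = 'C(2 * N, N).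
Proof.
move=> iN jN; rewrite -(subKn iN); elim: (N - i) (leq_subr i N) => [|d IH] dN.
  by rewrite subn0 win_count_top // win_count_right // addn0.
rewrite -IH; last by lia.
have -> : N - d = (N - d.+1).+1 by lia.
have hd : N - d.+1 < N by lia.
by rewrite (win_countS hd jN) (win_countS_right jN hd); lia.
Qed.

Lemma gap_count_gt0 (N s j : nat) : s < N -> j < N -> 0 < gap_count N s j.
Proof. by move=> sN jN; rewrite /gap_count muln_gt0 !bin_gt0; lia. Qed.

(** The two weights differ by [N * (s - j)], so the sign of [s - j] decides whether the gap count
    rises or falls; this is the unimodality. *)
Lemma gap_count_ratio (N s j : nat) : s < N -> j.+1 < N ->
  gap_count N s j.+1 * (j.+1 * (2 * N - s - j - 2)) =
  gap_count N s j * ((s + j + 2) * (N - j.+1)).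
Proof.
move=> sN jN; rewrite /gap_count.
have e1 : 'C(s + j.+1 + 1, s.+1) * j.+1 = (s + j + 2) * 'C(s + j + 1, s.+1).
  have := mul_bin_left (s + j + 1).+1 s.
  have := mul_bin_diag (s + j + 1).+1 s.
  have := mul_bin_down (s + j + 1).+1 s.+1.
  have -> : s + j.+1 + 1 = (s + j + 1).+1 by lia.
  rewrite /=; have -> : (s + j + 1).+1 - s.+1 = j.+1 by lia.
  have -> : (s + j + 1).+1 = s + j + 2 by lia.
  by lia.
have e2 : 'C(N - s.+1 + (N - j.+1), N - s.+1) * (N - j.+1) =
          (2 * N - s - j - 2) * 'C(N - s.+1 + (N - j.+2), N - s.+1).
  have := mul_bin_down (N - s.+1 + (N - j.+1)) (N - s.+1).
  have -> : N - s.+1 + (N - j.+1) - (N - s.+1) = N - j.+1 by lia.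
  have -> : (N - s.+1 + (N - j.+1)).-1 = N - s.+1 + (N - j.+2) by lia.
  have -> : 2 * N - s - j - 2 = N - s.+1 + (N - j.+1) by lia.
  by lia.
rewrite mulnACA e1 [RHS]mulnACA e2 [X in X * _ = _]mulnC.
by congr (_ * _); apply: mulnC.
Qed.

Lemma ltn_of_mul_eq (g g' x y : nat) : 0 < g -> g' * x = g * y -> x < y -> g < g'.
Proof.
move=> g_gt0 E xy; have : g * x < g' * x by rewrite E ltn_pmul2l.
by rewrite ltn_mul2r => /andP[].
Qed.

Lemma gap_count_ltS (N s j : nat) : j < s -> s < N ->
  gap_count N s j < gap_count N s j.+1.
Proof.
move=> js sN; have jN : j.+1 < N by lia.
apply: ltn_of_mul_eq (gap_count_ratio sN jN) _; first by rewrite gap_count_gt0 //; lia.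
have -> : 2 * N - s - j - 2 = (N - s.+1) + (N - j.+1) by lia.
have cmp : j.+1 * (N - s.+1) <= s * (N - j.+1) by apply: leq_mul; lia.
have : 0 < N - j.+1 by lia.
have -> : s + j + 2 = s.+1 + j.+1 by lia.
by rewrite mulnDr mulnDl; lia.
Qed.

Lemma gap_countS_lt (N s j : nat) : s < j -> j.+1 < N ->
  gap_count N s j.+1 < gap_count N s j.
Proof.
move=> sj jN; have sN : s < N by lia.
apply: ltn_of_mul_eq (esym (gap_count_ratio sN jN)) _; first by rewrite gap_count_gt0.
have -> : 2 * N - s - j - 2 = (N - s.+1) + (N - j.+1) by lia.
have cmp : s.+1 * (N - j.+1) <= j * (N - s.+1) by apply: leq_mul; lia.
have : 0 < N - s.+1 by lia.
have -> : s + j + 2 = s.+1 + j.+1 by lia.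
by rewrite mulnDr mulnDl; lia.
Qed.

Lemma gap_count_lt (N s j j' : nat) : j < j' -> j' <= s -> s < N ->
  gap_count N s j < gap_count N s j'.
Proof.
elim: j' => // j' IH; rewrite ltnS leq_eqVlt => /orP[/eqP ->|jj'] j's sN.
  exact: gap_count_ltS.
by apply: (ltn_trans (IH jj' (ltnW j's) sN)); apply: gap_count_ltS.
Qed.

Lemma gap_count_gt (N s j j' : nat) : s < j -> j < j' -> j' < N ->
  gap_count N s j' < gap_count N s j.
Proof.
move=> sj; elim: j' => // j' IH; rewrite ltnS leq_eqVlt => /orP[/eqP <-|jj'] j'N.
  exact: gap_countS_lt.
apply: (ltn_trans _ (IH jj' (ltnW j'N))); apply: gap_countS_lt => //.
exact: ltn_trans jj'.
Qed.

Lemma gap_count_le (N s j j' : nat) : j <= j' -> j' <= s -> s < N ->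
  gap_count N s j <= gap_count N s j'.
Proof.
rewrite leq_eqVlt => /orP[/eqP -> //|jj'] j's sN.
exact/ltnW/gap_count_lt.
Qed.

(** Downward induction on [i]: both sides lose the same increment, because reversal sends the gap
    [(i, j)] to [(N - i - 2, N - j - 1)]. *)
Lemma win_count_rev (N i j : nat) : i < N -> j < N ->
  win_count N (N - j.+1) (N - i.+1) = win_count N i j.
Proof.
move=> iN jN; have -> : i = N - (N - i) by lia.
have : N - i <= N by lia.
have : 0 < N - i by lia.
elim: (N - i) => // d IH _ dN {i iN}.
have jN' : N - j.+1 < N by lia.
have [->|d_gt0] := posnP d.
  have -> : N - (N - 1).+1 = 0 by lia.
  have N_gt0 : N - 1 < N by lia.
  have := win_countC (ltnW jN') (leq_ltn_trans (leq0n _) jN).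
  rewrite -(win_count_top jN).
  have e : (N - 1).+1 = N by lia.
  have := win_countS N_gt0 jN; rewrite e => ->; rewrite /gap_count e.
  rewrite [win_count N 0 _]/win_count big_ord1.
  have -> : N - 1 + j + 1 = N + j by lia.
  have -> : 2 * N - (0 + (N - j.+1) + 1) = N + j by lia.
  have -> : N - N + (N - j.+1) = N - j.+1 by lia.
  by rewrite subnn !bin0 subn0 mul1n muln1; lia.
have iN : N - d.+1 < N by lia.
have /(_ d_gt0 (ltnW dN)) := IH; have -> : N - d = (N - d.+1).+1 by lia.
rewrite (win_countS iN jN) => {IH}.
set x := N - d.+1 in iN *.
have e : N - x.+1 = (N - x.+2).+1 by lia.
have iN' : N - x.+2 < N by lia.
rewrite (win_countS_right jN' iN') -e.
suff -> : gap_count N (N - x.+2) (N - j.+1) = gap_count N x j by move/addIn.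
by rewrite /gap_count mulnC; congr ('C(_, _) * 'C(_, _)); lia.
Qed.

(** * Level crossings of the walk and reflection *)

(** With [a] and [b] independent, the last step of the walk can be removed: Pascal's rule on the
    second factor splits [(a + 1, b + 1)] into [(a, b + 1)] and [(a + 1, b)], and the right-hand
    side obeys the same recursion. *)
Lemma sum_ballot (a b k : nat) :
  \sum_(r < minn a b) 'C(2 * r + k + 1, r) * 'C((a - r.+1) + (b - r.+1), a - r.+1) =
  \sum_(j < minn a b) 'C(a + b + k, j).
Proof.
have pascal x y : 'C(x.+1 + y.+1, x.+1) = 'C(x.+1 + y, x.+1) + 'C(x + y.+1, x).
  by rewrite addnS binS addSnnS.
have [n] := ubnP (a + b); elim: n a b => // n IH a b abn.
wlog ab : a b abn / a <= b => [th|].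
  have /orP[ab|ba] := leq_total a b; first exact: th.
  rewrite minnC [a + b]addnC -th; [|lia|lia].
  apply: eq_bigr => r _; congr (_ * _).
  by rewrite -bin_sub; [congr 'C(_, _)|]; lia.
case: a b abn ab => [|a] [|b] //= abn ab; first by rewrite !min0n !big_ord0.
  by rewrite !min0n !big_ord0.
have sum_pascal m p : \sum_(j < m.+1) 'C(p.+1, j) = \sum_(j < m.+1) 'C(p, j) + \sum_(j < m)
  'C(p, j).
  by rewrite !big_ord_recl /= !bin0 -addnA -big_split.
have lower : \sum_(r < a) 'C(2 * r + k + 1, r) * 'C((a - r) + (b - r), a - r) =
    \sum_(r < a) 'C(2 * r + k + 1, r) * 'C((a - r) + (b - r.+1), a - r) +
    \sum_(r < a) 'C(2 * r + k + 1, r) * 'C((a - r.+1) + (b - r), a - r.+1).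
  rewrite -big_split; apply: eq_bigr => r _ /=; rewrite -mulnDr; congr (_ * _).
  have ra := ltn_ord r; have -> : a - r = (a - r.+1).+1 by lia.
  by have -> : b - r = (b - r.+1).+1 by lia.
have [p pE] : exists p, p = (a + b + k).+1 by eexists.
have -> : a.+1 + b.+1 + k = p.+1 by lia.
have upper : \sum_(r < a) 'C(2 * r + k + 1, r) * 'C((a - r.+1) + (b - r), a - r.+1) =
    \sum_(j < a) 'C(p, j).
  have := IH a b.+1; rewrite (minn_idPl (leqW (ab : a <= b))).
  have -> : a + b.+1 + k = p by lia.
  by move=> <- //; lia.
rewrite (minn_idPl _) // sum_pascal big_ord_recr /= !subSS subnn bin0 muln1.
under eq_bigr do rewrite !subSS.
rewrite lower upper.
(* On the diagonal the isolated term [r = a] is exactly the binomial ['C(p, a)] that the shorter sum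
   lacks; off the diagonal it is the last term of the sum for [(a.+1, b)]. *)
move: ab; rewrite ltnS leq_eqVlt => /orP[/eqP eab|ab].
  have right_sum : \sum_(r < a) 'C(2 * r + k + 1, r) * 'C((a - r) + (b - r.+1), a - r) =
      \sum_(j < a) 'C(p, j).
    have := IH a.+1 b; rewrite -eab (minn_idPr (leqnSn a)).
    have -> : a.+1 + a + k = p by lia.
    move=> <-; last by lia.
    by apply: eq_bigr => r _; rewrite subSS.
  rewrite right_sum [in RHS]big_ord_recr /= addnAC.
  by congr (_ + _ + _); congr binomial; lia.
rewrite addnAC; congr (_ + _).
have := IH a.+1 b; rewrite (minn_idPl ab).
have -> : a.+1 + b + k = p by lia.
move=> <-; last by lia.
rewrite big_ord_recr /= subnn bin0 muln1.
by congr (_ + _); apply: eq_bigr.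
Qed.

(* The walk that steps up on player 2's cards and down on player 1's meets the
   gap [(s, s - k)] exactly when it steps down from level [k + 1] to level [k];
   by reflection, the number of such steps over all walks is a sum of binomials. *)
Lemma sum_gap_count (N k : nat) : k <= N ->
  \sum_(k <= s < N) gap_count N s (s - k) = \sum_(j < N - k) 'C(2 * N, j).
Proof.
move=> kN; rewrite -{1}[k]add0n big_addn big_mkord.
have := sum_ballot (N - k) N k; rewrite (minn_idPl (leq_subr k N)).
have -> : N - k + N + k = 2 * N by lia.
move=> <-; apply: eq_bigr => r _; have rN := ltn_ord r.
rewrite addnK /gap_count; congr (_ * _).
  by rewrite -bin_sub; [congr 'C(_, _)|]; lia.
by congr 'C(_, _); lia.
Qed.

Lemma leq_bin_center (n a b : nat) : b <= n -> a <= b -> a <= n - b ->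
  'C(n, a) <= 'C(n, b).
Proof.
move=> bn; wlog : b bn / b <= n - b => [th ab anb|].
  have /orP[|nbb] := leq_total b (n - b); first by move/th; apply.
  by rewrite -(bin_sub bn); apply: th; lia.
move=> b_half ab _; rewrite -(subnK ab); have : b - a + a <= b by lia.
elim: (b - a) => // d IH dab; apply: (leq_trans (IH _)); first by lia.
have := mul_bin_left n (d + a); rewrite -addSn.
move: 'C(n, d + a) 'C(n, d.+1 + a) => x y E.
have : (d.+1 + a) * x <= (d.+1 + a) * y by rewrite E leq_mul2r; lia.
by rewrite leq_pmul2l; lia.
Qed.

(* Reflecting the part of the walk after its first [i + j + 1] steps sends the
   walks counted on the left to walks ending at level [-2 (j - i + 1)]. *)
Lemma win_count_le_bin (N i j : nat) : i < j -> j < N ->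
  win_count N i j <= 'C(2 * N, N - (j - i + 1)).
Proof.
move=> ij jN; set m := i + j + 1.
have -> : 2 * N = m + (2 * N - m) by rewrite /m; lia.
have iM : i.+1 <= (N - (j - i + 1)).+1 by lia.
rewrite -binomial.Vandermonde.
rewrite /win_count -/m (big_ord_widen _ (fun t => 'C(m, t) * 'C(2 * N - m, N - t)) iM).
rewrite [leqRHS](bigID (fun t : 'I__ => t < i.+1)) /=.
apply: leq_trans (leq_addr _ _); apply: leq_sum => t ti; rewrite leq_mul2l; apply/orP; right.
have [lt|le] := ltnP (2 * N - m) (N - t); first by rewrite bin_small.
rewrite -(bin_sub le); apply: leq_bin_center; rewrite /m in le *; lia.
Qed.

(** Rounding [k] up to the even number [2 h] makes both upper indices even, [2 M1] and [2 M2] with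
    [M1 + M2 = N], and puts both lower indices at distance [h] from the centre, where a single
    Gaussian bound applies. *)
Lemma gap_count_le_central (N s k : nat) (h := uphalf k) : k <= s -> s < N ->
  gap_count N s (s - k) <=
  'C(2 * (s.+1 - h), s.+1) * 'C(2 * (N - (s.+1 - h)), N - s.+1).
Proof.
move=> ks sN; have hk : k <= 2 * h <= k.+1.
  by rewrite /h uphalf_half; have := odd_double_half k; lia.
by apply: leq_mul; apply: leq_bin2l; lia.
Qed.

(** * Optimality and cyclic exchanges *)

Definition score (N : nat) (pi : 'S_N) : nat := \sum_(i < N) win_count N i (pi i).

Lemma optimalP (R : realType) (N : nat) (pi : 'S_N) :
  reflect (forall sigma : 'S_N, score sigma <= score pi) (optimal R pi).
Proof.
have tricksE (sigma : 'S_N) :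
    expected_tricks R sigma = ((score sigma)%:R / ('C(2 * N, N))%:R)%R.
  by rewrite expected_tricksE /score natr_sum mulr_suml.
apply: (iffP forallP) => opt sigma.
  have := opt sigma; rewrite !tricksE ler_pM2r ?ler_nat // invr_gt0 ltr0n bin_gt0.
  by rewrite leq_pmull.
by rewrite !tricksE ler_wpM2r ?ler_nat // invr_ge0 ler0n.
Qed.

Lemma win_count_sum_gap (N i i' j : nat) : i <= i' -> i' <= N -> j < N ->
  win_count N i' j = win_count N i j + \sum_(i <= s < i') gap_count N s j.
Proof.
move=> ii' i'N jN; elim: i' ii' i'N => [|i' IH].
  by rewrite leqn0 => /eqP -> _; rewrite big_geq // addn0.
rewrite leq_eqVlt => /orP[/eqP <- _|]; first by rewrite big_geq // addn0.
rewrite ltnS => ii' i'N; rewrite (win_countS i'N jN) IH //; last exact: ltnW.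
by rewrite big_nat_recr // addnA.
Qed.

Lemma sum_next (T : eqType) (g : T -> T -> nat) (x : T) (t : seq T) :
  uniq (x :: t) ->
  \sum_(i <- x :: t) g i (next (x :: t) i) = sumn (pairmap g x t) + g (last x t) x.
Proof.
move=> ut; suff gen x0 y p : uniq (y :: p) ->
    \sum_(i <- y :: p) g i (next_at i x0 y p) = sumn (pairmap g y p) + g (last y p) x0.
  exact: gen.
elim: p y => [|z p IH] y; first by rewrite big_seq1 /= eqxx.
move=> /= /andP[yzp zp_uniq]; rewrite big_cons eqxx -addnA; congr (_ + _).
rewrite -(IH z) //; apply: eq_big_seq => i izp.
by case: eqP => // iy; rewrite -iy izp in yzp.
Qed.

Lemma path_ltn_uniq (n : nat) (x : 'I_n) (t : seq 'I_n) :
  path (fun u v : 'I_n => u < v) x t -> uniq (x :: t).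
Proof.
have tr : transitive (fun u v : 'I_n => u < v) by move=> u v w; apply: ltn_trans.
have irr : irreflexive (fun u v : 'I_n => u < v) by move=> u; apply: ltnn.
exact: (sorted_uniq tr irr (s := x :: t)).
Qed.

Section Exchange.
Variables (N : nat) (pi : 'S_N).
Hypothesis pi_opt : forall sigma : 'S_N, score sigma <= score pi.

(** Each value moves to the next position of the cycle and nothing else changes, so optimality
    reduces to sums over the cycle. [cycle_values] rotates the values the other way. *)
Lemma cycle_positions (x : 'I_N) (t : seq 'I_N) : uniq (x :: t) ->
  sumn (pairmap (fun u v : 'I_N => win_count N v (pi u)) x t) +
    win_count N x (pi (last x t)) <= \sum_(i <- x :: t) win_count N i (pi i).
Proof.
move=> ut; pose tau := perm (can_inj (prev_next ut)).
have := pi_opt (tau^-1 * pi)%g; rewrite /score.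
rewrite (reindex_inj (@perm_inj _ tau)) /=.
rewrite (eq_bigr (fun i : 'I_N => win_count N (next (x :: t) i) (pi i))); last first.
  by move=> i _; rewrite permM permK permE.
set nx := next (x :: t).
rewrite (bigID (mem (x :: t))) [leqRHS](bigID (mem (x :: t))) /=.
rewrite [X in _ + X <= _](eq_bigr (fun i : 'I_N => win_count N i (pi i))); last first.
  by move=> i i_out; rewrite /nx next_nth (negbTE i_out).
by rewrite leq_add2r -!big_uniq // /nx (sum_next (fun u v : 'I_N => win_count N v (pi u))).
Qed.

Lemma cycle_values (x : 'I_N) (t : seq 'I_N) : uniq (x :: t) ->
  sumn (pairmap (fun u v : 'I_N => win_count N u (pi v)) x t) +
    win_count N (last x t) (pi x) <= \sum_(i <- x :: t) win_count N i (pi i).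
Proof.
move=> ut; pose tau := perm (can_inj (prev_next ut)).
have := pi_opt (tau * pi)%g; rewrite /score.
rewrite [leqLHS](eq_bigr (fun i : 'I_N => win_count N i (pi (next (x :: t) i)))); last first.
  by move=> i _; rewrite permM permE.
set nx := next (x :: t).
rewrite (bigID (mem (x :: t))) [leqRHS](bigID (mem (x :: t))) /=.
rewrite [X in _ + X <= _](eq_bigr (fun i : 'I_N => win_count N i (pi i))); last first.
  by move=> i i_out; rewrite /nx next_nth (negbTE i_out).
by rewrite leq_add2r -!big_uniq // /nx (sum_next (fun u v : 'I_N => win_count N u (pi v))).
Qed.

(** On an increasing chain every value but the last is taken over by a higher card, a gain that
    telescopes into gap counts; the last value, now played at the start, has to pay for all of
    them. *)
Lemma shift_positions (x : 'I_N) (t : seq 'I_N) : path (fun u v : 'I_N => u < v) x t ->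
  sumn (pairmap (fun u v : 'I_N => \sum_(u <= s < v) gap_count N s (pi u)) x t) +
    win_count N x (pi (last x t)) <= win_count N (last x t) (pi (last x t)).
Proof.
move=> xt; have ut := path_ltn_uniq xt.
have := cycle_positions ut.
suff E y : sumn (pairmap (fun u v : 'I_N => win_count N v (pi u)) x t) +
    win_count N (last x t) (pi (last x t)) + y =
  sumn (pairmap (fun u v : 'I_N => \sum_(u <= s < v) gap_count N s (pi u)) x t) +
    \sum_(i <- x :: t) win_count N i (pi i) + y.
  by have := E 0; lia.
congr (_ + _); elim: t x xt {ut} => [|z t IH] x /=; first by rewrite big_seq1.
move=> /andP[xz zt]; rewrite big_cons -!addnA IH //.
by rewrite (win_count_sum_gap (ltnW xz)) ?ltn_ord ?(ltnW (ltn_ord z)) //; lia.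
Qed.

Lemma shift_values (x : 'I_N) (t : seq 'I_N) : path (fun u v : 'I_N => u < v) x t ->
  win_count N (last x t) (pi x) <= win_count N x (pi x) +
    sumn (pairmap (fun u v : 'I_N => \sum_(u <= s < v) gap_count N s (pi v)) x t).
Proof.
move=> xt; have ut := path_ltn_uniq xt.
have := cycle_values ut.
suff E y : sumn (pairmap (fun u v : 'I_N => win_count N u (pi v)) x t) +
  sumn (pairmap (fun u v : 'I_N => \sum_(u <= s < v) gap_count N s (pi v)) x t) +
    win_count N x (pi x) + y =
    \sum_(i <- x :: t) win_count N i (pi i) + y.
  by have := E 0; lia.
congr (_ + _); elim: t x xt {ut} => [|z t IH] x /=; first by rewrite big_seq1.
move=> /andP[xz zt]; rewrite big_cons -IH //.
have := win_count_sum_gap (ltnW xz) (ltnW (ltn_ord z)) (ltn_ord (pi z)); lia.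
Qed.

Lemma swap_le (i i' : 'I_N) : i < i' ->
  \sum_(i <= s < i') gap_count N s (pi i) <= \sum_(i <= s < i') gap_count N s (pi i').
Proof.
move=> ii'; have := @shift_positions i [:: i']; rewrite /= ii' => /(_ isT).
rewrite addn0 (win_count_sum_gap (ltnW ii') (ltnW (ltn_ord i')) (ltn_ord (pi i'))).
by rewrite addnC leq_add2l.
Qed.

End Exchange.

Lemma leq_sum_interval (m n : nat) (f g : nat -> nat) :
  (forall s, m <= s < n -> f s <= g s) -> \sum_(m <= s < n) f s <= \sum_(m <= s < n) g s.
Proof. by move=> fg; rewrite big_nat [leqRHS]big_nat; apply: leq_sum. Qed.

Lemma ltn_sum_interval (m n : nat) (f g : nat -> nat) : m < n ->
  (forall s, m <= s < n -> f s < g s) -> \sum_(m <= s < n) f s < \sum_(m <= s < n) g s.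
Proof.
move=> mn fg; rewrite !(big_ltn mn) -addSn leq_add ?fg ?leqnn //.
by apply: leq_sum_interval => s /andP[ms sn]; apply/ltnW/fg; rewrite (ltnW ms).
Qed.

Lemma card_lt_le (n m : nat) (A : {set 'I_n}) :
  (forall a, a \in A -> a < m) -> #|A| <= m.
Proof.
move=> Am; have [mn|nm] := leqP m n; last first.
  by apply: leq_trans (ltnW nm); rewrite -[leqRHS](card_ord n) max_card.
rewrite -(card_ord_lt mn); apply/subset_leq_card/fintype.subsetP => a /Am.
by rewrite inE.
Qed.

Lemma card_gt_le (n m : nat) (A : {set 'I_n}) :
  (forall a, a \in A -> m <= a) -> #|A| <= n - m.
Proof.
move=> mA; rewrite -(card_imset _ (@rev_ord_inj n)).
by apply: card_lt_le => _ /imsetP[a /mA ma ->] /=; have := ltn_ord a; lia.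
Qed.

Lemma win_count_le_half (N i j : nat) : i <= j -> j < N ->
  2 * win_count N i j <= 'C(2 * N, N).
Proof.
move=> ij jN; rewrite -(win_countC (ltnW jN) jN) addnn -mul2n leq_pmul2l //.
by rewrite (win_count_sum_gap ij) ?leq_addr // ltnW.
Qed.

(** * Structure of optimal permutations *)

Section Structure.
Variables (N : nat) (pi : 'S_N).
Hypothesis pi_opt : forall sigma : 'S_N, score sigma <= score pi.

Definition throwers : {set 'I_N} := [set i : 'I_N | i < pi i].

Lemma in_throwers i : (i \in throwers) = (i < pi i).
Proof. by rewrite inE. Qed.

Lemma throwers_decreasing (i i' : 'I_N) : i < i' -> i < pi i -> i' < pi i' ->
  pi i' < pi i.
Proof.
move=> ii' iT i'T; rewrite ltnNge; apply/negP => le_pi.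
have {le_pi} jj' : pi i < pi i'.
  rewrite ltn_neqAle le_pi andbT; apply/eqP => /val_inj/perm_inj eq_ii'.
  by rewrite eq_ii' ltnn in ii'.
have := swap_le pi_opt ii'; apply/negP; rewrite -ltnNge.
have jN := ltn_ord (pi i); have j'N := ltn_ord (pi i').
have i'N := ltn_ord i'.
have [i'j|ji'] := leqP i' (pi i).
  apply: ltn_sum_interval => // s /andP[_ si'].
  by apply: gap_count_gt => //; apply: leq_trans i'j.
(* The square [[pi i, i')] of the rectangle of gaps cancels by [win_countC]. *)
have A : \sum_(i <= s < pi i) gap_count N s (pi i') < \sum_(i <= s < pi i) gap_count N s (pi i).
  by apply: ltn_sum_interval => // s /andP[_ sj]; apply: gap_count_gt.
have B : \sum_(pi i <= s < i') gap_count N s (pi i') < \sum_(pi i <= s < i') gap_count N s i'.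
  by apply: ltn_sum_interval => // s /andP[_ sj]; apply: gap_count_gt.
have w a b c (ab : a <= b) (bN : b < N) (cN : c < N) := win_count_sum_gap ab (ltnW bN) cN.
have := w _ _ _ (ltnW ii') i'N jN; have := w _ _ _ (ltnW ii') i'N j'N.
have := w _ _ _ (ltnW iT) jN jN; have := w _ _ _ (ltnW iT) jN j'N.
have := w _ _ _ (ltnW ji') i'N j'N; have := w _ _ _ (ltnW ji') i'N i'N.
have := win_countC (ltnW jN) jN; have := win_countC (ltnW i'N) i'N.
have := win_countC (ltnW jN) i'N.
by lia.
Qed.

Lemma winners_increasing (i i' : 'I_N) : i < i' -> pi i <= i -> pi i' <= i' ->
  pi i < pi i'.
Proof.
move=> ii' iW i'W; rewrite ltnNge; apply/negP => le_pi.
have {le_pi} jj' : pi i' < pi i.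
  rewrite ltn_neqAle le_pi andbT; apply/eqP => /val_inj/perm_inj eq_ii'.
  by rewrite eq_ii' ltnn in ii'.
have := swap_le pi_opt ii'; apply/negP; rewrite -ltnNge.
apply: ltn_sum_interval => // s /andP[is_ si'].
by apply: gap_count_lt => //; [lia|exact: ltn_trans (ltn_ord i')].
Qed.

Definition winners_below (m : nat) : {set 'I_N} := [set w : 'I_N | (w < m) && (pi w <= w)].

Lemma card_winners_below (m : nat) : m <= N ->
  #|winners_below m| + #|[set i in throwers | i < m]| = m.
Proof.
move=> mN; rewrite -[RHS](card_ord_lt mN) -(cardsID throwers [set c : 'I_N | c < m]) addnC.
by congr (_ + _); apply: eq_card => c; rewrite !inE -?leqNgt // andbC.
Qed.

Lemma leq_winners_below (m : nat) : m <= N -> m - #|throwers| <= #|winners_below m|.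
Proof.
move=> mN; rewrite leq_subLR -[leqLHS](card_winners_below mN) addnC leq_add2r.
by apply: subset_leq_card; apply/fintype.subsetP => c; rewrite inE => /andP[].
Qed.

(** The winners before [w] hold distinct smaller values. This rank bound replaces the unknown values
    in the estimates below. *)
Lemma winners_below_le (w : 'I_N) : pi w <= w -> #|winners_below w| <= pi w.
Proof.
move=> wW; rewrite -(card_imset _ (@perm_inj _ pi)).
apply: card_lt_le => _ /imsetP[v + ->]; rewrite inE => /andP[vw vW].
exact: winners_increasing.
Qed.

(* The first winner is turned into a thrower of the largest value won, and every
   other winner takes over the value of its predecessor. *)
Lemma sum_gap_count_le (k := #|throwers|) : 0 < N ->
  \sum_(k <= s < N) gap_count N s (s - k) <= 'C(2 * N, N).
Proof.
move=> N_gt0; have N1N : N.-1 < N by rewrite prednK.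
pose last_pos := Ordinal N1N.
have lastW : pi last_pos <= last_pos by rewrite /= -ltnS prednK.
pose R (u v : 'I_N) := [&& u < v, pi u <= u & [forall w : 'I_N, (u < w < v) ==> (w < pi w)]].
have next_winner (u : 'I_N) : pi u <= u -> u < N.-1 -> {v : 'I_N | R u v & pi v <= v}.
  move=> uW uN; pose PP (w : 'I_N) := (u < w) && (pi w <= w).
  have Plast : PP last_pos by rewrite /PP /= uN lastW.
  case: (@arg_minnP _ last_pos PP (fun w : 'I_N => val w) Plast) => v /andP[uv vW] min_v;
    exists v => //.
  rewrite /R uv uW; apply/forallP => w; apply/implyP => /andP[uw wv].
  by rewrite ltnNge; apply/negP => wW; have := min_v w; rewrite /PP uw wW => /(_ isT);
    rewrite leqNgt wv.
have walk (u : 'I_N) : pi u <= u -> {t | path R u t & last u t = last_pos}.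
  have [n] := ubnP (N - u); elim: n u => // n IH u un uW.
  have [uN|] := ltnP u N.-1; last first.
    move=> Nu; exists [::] => //=; apply: val_inj => /=; have := ltn_ord u; lia.
  have [v Ruv vW] := next_winner u uW uN.
  have [|t vt t_last] := IH v _ vW; first by have /andP[] := Ruv; lia.
  by exists (v :: t) => //=; rewrite Ruv.
pose PP (w : 'I_N) := pi w <= w.
have Plast : PP last_pos by [].
case: (@arg_minnP _ last_pos PP (fun w : 'I_N => val w) Plast) => x xW min_x.
have [t xt t_last] := walk x xW.
have x_le : x <= k.
  rewrite -[leqLHS](card_ord_lt (ltnW (ltn_ord x))); apply/subset_leq_card/fintype.subsetP => c.
  by rewrite !inE => cx; rewrite ltnNge; apply/negP => /min_x; rewrite leqNgt cx.
have lt_t : path (fun u v : 'I_N => u < v) x t.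
  by apply: sub_path xt => u v /andP[].
have := shift_positions pi_opt lt_t; rewrite t_last.
(* Below [k] the truncated difference [s - k] would give 0 instead of a negative index; such terms
   are absent from the target sum. *)
pose F s := if k <= s then gap_count N s (s - k) else 0.
have lower : \sum_(x <= s < last x t) F s <=
    sumn (pairmap (fun u v : 'I_N => \sum_(u <= s < v) gap_count N s (pi u)) x t).
  elim: t {x_le min_x t_last lt_t} x xt {xW} => [|v t IH] x /=; first by rewrite big_geq.
  case/andP => Rxv vt; have /and3P[xv xW /forallP btw] := Rxv.
  have v_last : v <= last v t.
    elim: t v vt {Rxv xv btw IH} => //= w t IH v /andP[/andP[vw _] wt].
    exact: leq_trans (ltnW vw) (IH _ wt).
  rewrite (big_cat_nat (ltnW xv) v_last) leq_add ?IH //=.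
  apply: leq_sum_interval => s /andP[xs sv]; rewrite /F; case: (leqP k s) => // ks.
  apply: gap_count_le => //; last exact: ltn_trans (ltn_ord v).
    (* Only [x] separates the winners below [v] from those below [x], so the value at [x] is at
       least [v - k - 1], hence at least [s - k] for every [s < v]. *)
    apply: leq_trans (winners_below_le xW).
    have -> : #|winners_below x| = #|winners_below v|.-1.
      have -> : winners_below v = x |: winners_below x.
        apply/finset.setP => w; rewrite !inE -val_eqE /=.
        case: (ltngtP w x) => [wx|xw|/val_inj ->] /=; rewrite ?xW ?xv //.
          by rewrite (ltn_trans wx xv).
        by apply/negbTE/negP => /andP[wv]; have /implyP := btw w;
          rewrite xw wv ltnNge => /(_ isT)/negbTE->.
      by rewrite cardsU1 inE ltnn.
    by have := leq_winners_below (ltnW (ltn_ord v)); rewrite -/k; lia.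
  exact: leq_trans xs.
set y := pi last_pos; move: lower; rewrite t_last => lower upper.
have [kN|Nk] := ltnP k N; last by rewrite big_geq.
have -> : \sum_(k <= s < N) gap_count N s (s - k) =
    \sum_(x <= s < N.-1) F s + gap_count N N.-1 (N.-1 - k).
  have {1}-> : N = N.-1.+1 by rewrite prednK.
  rewrite big_nat_recr /=; last by rewrite -ltnS prednK.
  congr (_ + _); rewrite (big_cat_nat (n := k) x_le) /=; last by rewrite -ltnS prednK.
  rewrite [X in _ = X + _]big_nat [X in _ = X + _]big1; last first.
    by move=> s /andP[_ sk]; rewrite /F leqNgt sk.
  by rewrite add0n; apply: eq_big_nat => s /andP[ks _]; rewrite /F ks.
have yN := ltn_ord y.
have gap_last : gap_count N N.-1 (N.-1 - k) <= gap_count N N.-1 y.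
  apply: gap_count_le => //; apply: leq_trans (winners_below_le lastW).
  exact/leq_winners_below/ltnW.
(* The missing term [s = N - 1] is the increment towards the fictitious top card, at which the count
   is all of ['C(2 * N, N)]. *)
rewrite -(win_count_top yN); have := win_countS N1N yN; rewrite prednK // => ->.
apply: leq_add => //; exact: leq_trans lower (leq_trans (leq_addr _ _) upper).
Qed.

(* The last thrower [i] is turned into a winner: the values played in the
   positions [i .. pi i + k - 1] are shifted cyclically. *)
Lemma sum_gap_count_ge (i : 'I_N) (k := #|throwers|) :
  i < pi i -> (forall i', i' \in throwers -> i' <= i) ->
  pi i + k.-1 < N /\
  win_count N (pi i + k.-1) (pi i) <=
    win_count N i (pi i) + \sum_(i <= s < pi i + k.-1) gap_count N s (s.+1 - k).
Proof.
move=> iT max_i; set j := pi i; set b := j + k.-1.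
have k_gt0 : 0 < k by apply/card_gt0P; exists i; rewrite inE.
have min_j i' : i' \in throwers -> j <= pi i'.
  move=> i'T; have := max_i _ i'T; rewrite leq_eqVlt => /orP[/eqP/val_inj -> //|i'i].
  by apply: ltnW; apply: throwers_decreasing => //; rewrite inE in i'T.
have kj : k <= N - j.
  rewrite /k -(card_imset _ (@perm_inj _ pi)).
  by apply: card_gt_le => _ /imsetP[i' i'T ->]; apply: min_j.
have bN : b < N by have := ltn_ord j; rewrite /b; lia.
split=> //.
have late_winner (v : 'I_N) : i < v -> pi v <= v.
  by move=> iv; rewrite leqNgt; apply/negP; rewrite -in_throwers => /max_i; rewrite leqNgt iv.
(* All [k] throwers precede [v], so [v - k] winners do, and these hold every value below both [pi v]
   and [j], as thrown values are at least [j]. Thus [minn (pi v) j <= v - k]; the end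
   [b = j + k - 1] is the last position where [j <= v - k] is impossible. *)
have value_le (v : 'I_N) : i < v -> v <= b -> pi v <= v - k.
  move=> iv vb; have vW := late_winner _ iv.
  have card_v : #|winners_below v| = v - k.
    rewrite -[X in X - k](card_winners_below (ltnW (ltn_ord v))).
    have -> : [set i0 in throwers | i0 < v] = throwers; last by rewrite addnK.
    apply/finset.setP => c; rewrite !inE andbC; case: ltnP => //= vc.
    by apply/esym/negbTE; rewrite -in_throwers; apply/negP => /max_i; lia.
  have j_gt0 : 0 < j by apply: leq_ltn_trans iT.
  suff : minn (pi v) j <= v - k.
    by rewrite geq_min => /orP[//|jv]; move: vb; rewrite /b; clear -k_gt0 j_gt0 jv; lia.
  have minN : minn (pi v) j <= N by have := ltn_ord j; lia.
  rewrite -card_v -[leqLHS](card_ord_lt minN) -(card_imset _ (@perm_inj _ pi)).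
  apply/subset_leq_card/fintype.subsetP => y; rewrite inE => y_lt; apply/imsetP.
  exists (pi^-1 y)%g; last by rewrite permKV.
  have uW : pi (pi^-1 y)%g <= (pi^-1 y)%g.
    rewrite leqNgt -in_throwers; apply/negP => /min_j; rewrite permKV; lia.
  rewrite inE uW andbT ltnNge leq_eqVlt; apply/negP => /orP[/eqP/val_inj vE|vu].
    by move: y_lt; rewrite vE permKV; lia.
  by have := winners_increasing vu vW uW; rewrite permKV; lia.
pose R (u v : 'I_N) := (val v == u.+1) && (i < v <= b).
have [t it t_last] : exists2 t, path R i t &
    val (last i t) = b.
  have ib : i <= b := leq_trans (ltnW iT) (leq_addr _ _).
  have : forall u : 'I_N, i <= u -> u <= b ->
    exists2 t, path R u t & val (last u t) = b; last by apply.
  move=> u; have [n] := ubnP (b - u); elim: n u => // n IH u un iu ub.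
  have [ubE|u_neq] := eqVneq (val u) b; first by exists [::].
  have {u_neq} ub' : u < b by rewrite ltn_neqAle u_neq.
  have uN : u.+1 < N := leq_ltn_trans ub' bN.
  have [|||t ut t_last] := IH (Ordinal uN); rewrite /=; try lia.
  by exists (Ordinal uN :: t) => //=; rewrite ut andbT /R eqxx /=; lia.
have lt_t : path (fun u v : 'I_N => u < v) i t.
  by apply: sub_path it => u v /andP[/eqP -> _].
have := shift_values pi_opt lt_t; rewrite t_last => /leq_trans; apply.
rewrite leq_add2l -t_last.
elim: t {lt_t t_last} (i) it => [|v t IH] u /=; first by rewrite big_geq.
case/andP => /andP[/eqP vu /andP[iv vb]] vt.
have v_last : v <= last v t.
  elim: t v vt {vu iv vb IH} => //= w t IH v /andP[/andP[/eqP wv _] wt].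
  by apply: leq_trans (IH _ wt); rewrite wv.
have uv : u <= v by rewrite vu.
rewrite (big_cat_nat uv v_last); apply: leq_add; last exact: IH.
rewrite vu !big_nat1 -vu.
apply: gap_count_le; rewrite ?value_le //.
  by rewrite vu; lia.
Qed.

(** The last winner before the last thrower has exactly [i - k] winners before it, so its value is
    at least [i - k]. As exchanging the two does not pay, some [s] between them has a gap count at
    that value no larger than at [pi i], and lowering the value to [i - k] only decreases it. *)
Lemma swap_last_thrower (i i' : 'I_N) (k := #|throwers|) :
  i < pi i -> (forall c, c \in throwers -> c <= i) -> pi i' <= i' -> i' < i ->
  exists s, [/\ s < i, i - k <= s, k <= i & gap_count N s (i - k) <= gap_count N s (pi i)].
Proof.
move=> iT max_i i'W0 i'i0.
pose PP (w : 'I_N) := (w < i) && (pi w <= w).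
have PPi' : PP i' by rewrite /PP i'i0.
case: (@arg_maxnP _ i' PP (fun w : 'I_N => val w) PPi') => {i'W0 i'i0 PPi'} {}i' /andP[i'i i'W]
  max_i'.
have card_i : #|winners_below i.+1| + k = i.+1.
  rewrite -[RHS](card_winners_below (ltn_ord i)); congr (_ + _).
  apply: eq_card => c; rewrite inE ltnS; apply/idP/andP => [cT|[]//].
  by split=> //; apply: max_i.
have eq_below : winners_below i.+1 = i' |: winners_below i'.
  apply/finset.setP => w; rewrite !inE ltnS -val_eqE /=.
  have [->|wi'] := eqVneq w i'; first by rewrite (ltnW i'i) i'W eqxx.
  rewrite (inj_eq val_inj) (negbTE wi') /=; case: (leqP (pi w) w) => wW; rewrite ?andbF // !andbT.
  apply/idP/idP => [wi|]; last by move=> /ltnW/leq_trans; apply; apply: ltnW.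
  have {}wi : w < i.
    by rewrite ltn_neqAle wi andbT; apply/eqP => /val_inj E; rewrite E leqNgt iT in wW.
  have := max_i' w; rewrite /PP wi wW => /(_ isT) w_le.
  by rewrite ltn_neqAle (w_le : w <= i') andbT (inj_eq val_inj).
have card_i' : #|winners_below i'| = i - k.
  by move: card_i; rewrite eq_below cardsU1 inE ltnn /=; lia.
have rank_i' : i - k <= pi i' by rewrite -card_i' winners_below_le.
have ki : k <= i by move: card_i; rewrite eq_below cardsU1 inE ltnn /=; lia.
have : ~~ (\sum_(i' <= s < i) gap_count N s (pi i) < \sum_(i' <= s < i) gap_count N s (pi i')).
  by rewrite -leqNgt swap_le.
move=> not_lt.
have [s /andP[i's si] le_s] : exists2 s, i' <= s < i & gap_count N s (pi i') <= gap_count N s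
  (pi i).
  apply: contrapT => no_s; move/negP: not_lt; apply; apply: ltn_sum_interval => // s s_in.
  by rewrite ltnNge; apply/negP => le_s; apply: no_s; exists s.
exists s; split=> //; first exact: leq_trans rank_i' (leq_trans i'W i's).
apply: leq_trans le_s; apply: gap_count_le => //; first exact: leq_trans i'W i's.
exact: ltn_trans (ltn_ord i).
Qed.

(** The hypotheses fix which positions throw and which values are thrown; inside each class
    monotonicity fixes the matching by counting. *)
Lemma eq_throw (k := #|throwers|) :
  (forall i i' : 'I_N, i' < i -> i \in throwers -> i' \in throwers) ->
  (forall i i' : 'I_N, pi i < pi i' -> i \in throwers -> i' \in throwers) ->
  pi = throw N k.
Proof.
move=> initial terminal.
have throwersE (i : 'I_N) : (i \in throwers) = (i < k).
  apply/idP/idP => [iT|].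
    rewrite /k -(card_ord_lt (ltn_ord i)); apply/subset_leq_card/fintype.subsetP => c.
    by rewrite [c \in [set _ | _]]inE ltnS leq_eqVlt => /orP[/eqP/val_inj -> //|/initial]; apply.
  apply: contraLR => iW; rewrite -leqNgt; apply: card_lt_le => c cT.
  rewrite ltnNge leq_eqVlt; apply/negP => /orP[/eqP/val_inj ic|/initial/(_ cT) iT].
    by rewrite ic cT in iW.
  by rewrite iT in iW.
apply/permP => i; rewrite permE /throw_fun; case: ltnP => ik; apply/val_inj => /=.
  have iT : i < pi i by rewrite -in_throwers throwersE.
  have lower : N - (pi i).+1 <= i.
    have -> : N - (pi i).+1 = #|[set y : 'I_N | pi i < y]|.
      rewrite cardsCs card_ord -[in LHS](card_ord_lt (ltn_ord (pi i))).
      by congr (_ - _); apply: eq_card => y; rewrite !inE -leqNgt ltnS.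
    rewrite -(card_imset _ (@perm_inj _ pi^-1)).
    apply: card_lt_le => _ /imsetP[y + ->]; rewrite inE => iy.
    have yT : (pi^-1 y)%g \in throwers by apply: (terminal i); rewrite ?permKV ?in_throwers.
    rewrite ltnNge leq_eqVlt; apply/negP => /orP[/eqP/val_inj E|lt].
      by move: iy; rewrite E permKV ltnn.
    have := throwers_decreasing lt iT; rewrite -in_throwers permKV => /(_ yT).
    by rewrite ltnNge ltnW.
  have upper : i <= N - (pi i).+1.
    rewrite -[leqLHS](card_ord_lt (ltnW (ltn_ord i))) -(card_imset _ (@perm_inj _ pi)).
    apply: card_gt_le => _ /imsetP[c + ->]; rewrite inE => ci.
    apply: throwers_decreasing => //.
    by rewrite -in_throwers throwersE (ltn_trans ci).
  by have := ltn_ord (pi i); lia.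
have iW : pi i <= i by rewrite leqNgt -in_throwers throwersE -leqNgt.
have card_i : #|winners_below i| = i - k.
  have := card_winners_below (ltnW (ltn_ord i)).
  have -> : [set c in throwers | c < i] = throwers.
    apply/finset.setP => c; rewrite inE throwersE; apply/andP/idP => [[]//|ck].
    by split=> //; apply: leq_trans ik.
  by rewrite -/k; lia.
apply/eqP; rewrite eqn_leq -card_i winners_below_le // andbT.
rewrite -[leqLHS](card_ord_lt (ltnW (ltn_ord (pi i)))) -[leqLHS](card_imset _ (@perm_inj _
  pi^-1)).
apply/subset_leq_card/fintype.subsetP => _ /imsetP[y + ->]; rewrite inE => yi.
have yW : pi (pi^-1 y)%g <= (pi^-1 y)%g.
  rewrite leqNgt -in_throwers; apply/negP => yT.
  have := terminal _ i _ yT; rewrite permKV => /(_ yi); rewrite in_throwers ltnNge iW.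
  by [].
rewrite inE yW andbT ltnNge leq_eqVlt; apply/negP => /orP[/eqP/val_inj E|lt].
  by move: yi; rewrite E permKV ltnn.
by have := winners_increasing lt iW yW; rewrite permKV ltnNge ltnW.
Qed.

End Structure.

(** * Symmetry, and consequences of optimality for throws *)

(* Turning the deck upside down and exchanging the players. *)
Definition flip (N : nat) (pi : 'S_N) : 'S_N :=
  (perm (@rev_ord_inj N) * pi^-1 * perm (@rev_ord_inj N))%g.

Lemma flipE (N : nat) (pi : 'S_N) (i : 'I_N) : flip pi (rev_ord (pi i)) = rev_ord i.
Proof. by rewrite /flip !permM [perm _ (rev_ord _)]permE rev_ordK permK permE. Qed.

Lemma score_flip (N : nat) (pi : 'S_N) : score (flip pi) = score pi.
Proof.
rewrite /score (reindex_inj (inj_comp (@rev_ord_inj N) (@perm_inj _ pi))) /=.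
by apply: eq_bigr => i _; rewrite flipE /= win_count_rev.
Qed.

Lemma throwers_flip (N : nat) (pi : 'S_N) (i : 'I_N) :
  (rev_ord (pi i) \in throwers (flip pi)) = (i \in throwers pi).
Proof. by rewrite !in_throwers flipE /=; have := ltn_ord i; have := ltn_ord (pi i); lia. Qed.

Lemma card_throwers_flip (N : nat) (pi : 'S_N) : #|throwers (flip pi)| = #|throwers pi|.
Proof.
have inj := inj_comp (@rev_ord_inj N) (@perm_inj _ pi).
rewrite -[RHS](card_imset _ inj); apply: eq_card => c.
have -> : c = rev_ord (pi (pi^-1 (rev_ord c))%g) by rewrite permKV rev_ordK.
by rewrite throwers_flip (mem_imset _ _ inj).
Qed.

(** For large [k] the reversed block of [throw N k] reaches positions that win. Optimality forbids
    this: such a winner and a neighbour would be two winners in decreasing order. *)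
Lemma throwers_throw (N k : nat) : 2 < N -> k <= N ->
  (forall sigma : 'S_N, score sigma <= score (throw N k)) ->
  throwers (throw N k) = [set i : 'I_N | i < k].
Proof.
move=> N2 kN opt.
have throwE (i : 'I_N) : throw N k i = (if i < k then N - i.+1 else i - k) :> nat.
  by rewrite permE /throw_fun; case: ifP.
apply/finset.setP => i; rewrite !inE throwE; case: (ltnP i k) => ik;
  last by rewrite ltnNge leq_subr.
rewrite ltnNge; apply/negP => iW.
have lt_values (u v : 'I_N) : u < v -> throw N k u <= u -> throw N k v <= v ->
    throw N k u < throw N k v by exact: (winners_increasing opt).
have [iN|Ni] := ltnP i.+1 N.
  have := lt_values i (Ordinal iN) (ltnSn _).
  rewrite !throwE ik /=; case: (ltnP i.+1 k) => ik' /(_ iW); lia.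
(* At the last position the neighbour lies to the left and plays against value 1; it is a winner
   because [N > 2]. *)
have iN : i.-1 < N by have := ltn_ord i; lia.
have := @lt_values (Ordinal iN) i; rewrite !throwE ik /= (leq_ltn_trans (leq_pred i) ik).
by have := ltn_ord i; lia.
Qed.

(** The last throw, from position [k - 1] at value [N - k], is undone. Its own winning probability
    is at most 1/2, which produces the factor 2; the increment to the fictitious top card supplies
    the term [s = N - 1]. *)
Lemma throw_optimal_le (N k : nat) : 2 < N -> 0 < k -> k <= N ->
  (forall sigma : 'S_N, score sigma <= score (throw N k)) ->
  'C(2 * N, N) <= 2 * \sum_(j < N - k.-1) 'C(2 * N, j).
Proof.
move=> N2 k_gt0 kN opt; have TE := throwers_throw N2 kN opt.
have cT : #|throwers (throw N k)| = k by rewrite TE card_ord_lt.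
have i_lt : k.-1 < N by lia.
pose i := Ordinal i_lt.
have iT : i \in throwers (throw N k) by rewrite TE inE /=; lia.
have jE : throw N k i = N - k :> nat by rewrite permE /throw_fun /= ltn_predL k_gt0 /=; lia.
have max_i c : c \in throwers (throw N k) -> c <= i by rewrite TE inE /=; lia.
have iT' : i < throw N k i by rewrite -in_throwers.
have [_] := sum_gap_count_ge opt iT' max_i; rewrite cT.
have jN := ltn_ord (throw N k i); have half := win_count_le_half (ltnW iT') jN.
move: half; rewrite jE in jN *; move=> /= half.
have -> : N - k + k.-1 = N.-1 by lia.
have N1 : N.-1 < N by lia.
have := win_countS N1 jN; rewrite prednK ?(ltnW (ltnW N2)) // (win_count_top jN) => topE.
rewrite -(sum_gap_count (ltnW i_lt)).
have -> : \sum_(k.-1 <= s < N) gap_count N s (s - k.-1) =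
   \sum_(k.-1 <= s < N.-1) gap_count N s (s.+1 - k) + gap_count N N.-1 (N - k).
  have {1}-> : N = N.-1.+1 by lia.
  rewrite big_nat_recr /=; last by lia.
  by congr (_ + gap_count _ _ _); [apply: eq_big_nat => s sk; congr gap_count|]; lia.
lia.
Qed.

(* What optimality says about the last thrower [i], with value [j], of a permutation
   that is not a [throw N k]: neither moving its throw to an earlier winner nor
   undoing it is profitable.  These two facts are incompatible for large [N]. *)
Variant misplaced_throw (N k i j : nat) : Prop := MisplacedThrow of
  i < j & j + k.-1 < N & 0 < k & k <= i &
  (exists s, [/\ s < i, i - k <= s & gap_count N s (i - k) <= gap_count N s j]) &
  win_count N (j + k.-1) j <=
    win_count N i j + \sum_(i <= s < j + k.-1) gap_count N s (s.+1 - k).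

Lemma optimal_throw_dichotomy (N : nat) (pi : 'S_N) (k := #|throwers pi|) :
  (forall sigma : 'S_N, score sigma <= score pi) ->
  pi = throw N k \/ exists i j, misplaced_throw N k i j.
Proof.
move=> opt.
have misplaced (sigma : 'S_N) (i i' : 'I_N) :
    (forall tau : 'S_N, score tau <= score sigma) -> #|throwers sigma| = k ->
    i' < i -> i \in throwers sigma -> i' \notin throwers sigma ->
    exists i j, misplaced_throw N k i j.
  move=> opt_s cT i'i iT i'W.
  case: (@arg_maxnP _ i (mem (throwers sigma)) (fun w : 'I_N => val w) iT) => m mT max_m.
  have max_m' c : c \in throwers sigma -> c <= m by move/max_m.
  have mT' : m < sigma m by rewrite -in_throwers.
  have i'm : i' < m by apply: leq_trans i'i (max_m' _ iT).
  rewrite in_throwers -leqNgt in i'W.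
  have [s [sm ms km gap_le]] := swap_last_thrower opt_s mT' max_m' i'W i'm.
  have [bN win_le] := sum_gap_count_ge opt_s mT' max_m'.
  rewrite cT in ms km gap_le bN win_le.
  exists m, (sigma m); split=> //; last by exists s.
  by rewrite -cT; apply/card_gt0P; exists m.
have [initial|] := pselect (forall i i' : 'I_N, i' < i -> i \in throwers pi -> i' \in throwers
  pi).
  have [terminal|] := pselect (forall i i' : 'I_N, pi i < pi i' -> i \in throwers pi -> i' \in
    throwers pi).
    by left; apply: eq_throw.
  move=> /existsNP[i /existsNP[i' /not_implyP[ii' /not_implyP[iT /negP i'W]]]]; right.
  (* Thrown values that are not terminal become throwing positions that are not initial after the
     flip. *)
  apply: (@misplaced (flip pi) (rev_ord (pi i)) (rev_ord (pi i'))).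
  - by move=> tau; rewrite score_flip.
  - exact: card_throwers_flip.
  - by rewrite /=; have := ltn_ord (pi i'); lia.
  - by rewrite throwers_flip.
  - by rewrite throwers_flip.
move=> /existsNP[i /existsNP[i' /not_implyP[ii' /not_implyP[iT /negP i'W]]]]; right.
exact: (misplaced pi i i').
Qed.

(** * Gaussian and Mills ratio bounds for binomial tails *)

Local Open Scope ring_scope.

(** Each factor [(N - m) / (N + m + 1)] of [bin_ratio] is [(1 - y) / (1 + y)] with
    [y = (2m + 1) / (2N + 1)]; the error here is of third order in [y], so the Gaussian upper bound
    loses little. *)
Lemma subr1_le_expR (R : realType) (y : R) : 0 <= y ->
  1 - y <= (1 + y) * expR (- (2 * y)).
Proof.
move=> y0; pose f (x : R) := (1 + x) * expR (- x) - (1 - x) * expR x.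
pose f' (x : R) := x * (expR x - expR (- x)).
have df (x : R) : is_derive x (1 : R) f (f' x).
  by apply: is_derive_eq; rewrite /f' /GRing.scale /=; ring.
have fge0 : 0 <= f y.
  have [->|yneq0] := eqVneq y 0; first by rewrite /f oppr0 expR0; lra.
  have y_gt0 : 0 < y by rewrite lt_def yneq0.
  have [|c] := @MVT R f f' 0 y y_gt0 (fun x _ => df x).
    by apply: continuous_subspaceT => x; apply/differentiable_continuous/derivable1_diffP.
  rewrite in_itv /= => /andP[c0 cy] E.
  have f0 : f 0 = 0 by rewrite /f oppr0 expR0; lra.
  move: E; rewrite f0 subr0 => ->; rewrite !mulr_ge0 ?subr0 ?(ltW c0) //.
  by rewrite subr_ge0 ler_expR; lra.
have -> : - (2 * y) = - y + - y by ring.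
rewrite expRD mulrA -[leLHS]mulr1 -[X in _ * X <= _](expRxMexpNx_1 y) mulrA ler_wpM2r ?expR_ge0
  //.
by move: fge0; rewrite /f subr_ge0.
Qed.

Definition bin_ratio (R : realType) (N m : nat) : R :=
  ('C(2 * N, N - m))%:R / ('C(2 * N, N))%:R.

Definition bin_tail (R : realType) (N k : nat) : R :=
  (\sum_(j < N - k) 'C(2 * N, j))%:R / ('C(2 * N, N))%:R.

Lemma central_bin_gt0 (R : realType) (N : nat) : 0 < ('C(2 * N, N))%:R :> R.
Proof. by rewrite ltr0n bin_gt0 leq_pmull. Qed.

Lemma bin_ratio0 (R : realType) (N : nat) : bin_ratio R N 0 = 1.
Proof. by rewrite /bin_ratio subn0 divff // gt_eqF // central_bin_gt0. Qed.

Lemma bin_ratio_ge0 (R : realType) (N m : nat) : 0 <= bin_ratio R N m.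
Proof. by rewrite mulr_ge0 ?invr_ge0 ?ler0n. Qed.

Lemma bin_ratioS (R : realType) (N m : nat) : (m < N)%N ->
  (N%:R + m%:R + 1) * bin_ratio R N m.+1 = (N%:R - m%:R) * bin_ratio R N m.
Proof.
move=> mN; rewrite /bin_ratio !mulrA; congr (_ / _).
have -> : (N - m = (N - m.+1).+1)%N by lia.
have := mul_bin_left (2 * N) (N - m.+1).
have -> : (2 * N - (N - m.+1) = N + m + 1)%N by lia.
have -> : ((N - m.+1).+1 = N - m)%N by lia.
move/(congr1 (fun x : nat => x%:R : R)); rewrite !natrM !natrD natrB ?(ltnW mN) //.
Qed.

Lemma bin_tail_ge0 (R : realType) (N k : nat) : 0 <= bin_tail R N k.
Proof. by rewrite mulr_ge0 ?invr_ge0 ?ler0n. Qed.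

Lemma bin_tailS (R : realType) (N k : nat) : (k < N)%N ->
  bin_tail R N k = bin_ratio R N k.+1 + bin_tail R N k.+1.
Proof.
move=> kN; rewrite /bin_tail -mulrDl -natrD; congr (_%:R / _).
by have -> : (N - k = (N - k.+1).+1)%N; [lia|rewrite big_ord_recr /= addnC].
Qed.

Lemma bin_tail_le (R : realType) (N k k' : nat) : (k <= k')%N ->
  bin_tail R N k' <= bin_tail R N k.
Proof.
move=> kk'; rewrite ler_pM2r ?invr_gt0 ?central_bin_gt0 // ler_nat.
have le_sub : (N - k' <= N - k)%N by lia.
rewrite (big_ord_widen _ (fun j => 'C(2 * N, j)) le_sub).
by rewrite [leqRHS](bigID (fun j : 'I__ => j < N - k')%N) leq_addr.
Qed.

(* Discrete form of the Mills ratio bound [x / (1 + 2 x^2)] for the tail of [exp (- x^2)]. *)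
Lemma bin_tail_ge (R : realType) (N k : nat) : (k <= N)%N ->
  k%:R * (N%:R - k%:R) * bin_ratio R N k <=
  bin_tail R N k * (N%:R + 2 * k%:R ^+ 2 + k%:R).
Proof.
move=> kN; rewrite -(subKn kN); elim: (N - k)%N (leq_subr k N) => [|d IH] dN.
  by rewrite subn0 subrr mulr0 mul0r mulr_ge0 ?bin_tail_ge0 // !addr_ge0 ?mulr_ge0 ?exprn_ge0
    ?ler0n.
have := IH (ltnW dN); set m := (N - d.+1)%N.
have mN : (m < N)%N by rewrite /m; lia.
have -> : (N - d = m.+1)%N by rewrite /m; lia.
have := bin_ratioS R mN; rewrite (bin_tailS R mN).
have : 0 <= m%:R :> R by rewrite ler0n.
have : m%:R + 1 <= N%:R :> R by rewrite natr1 ler_nat.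
have := bin_ratio_ge0 R N m.+1; have := bin_tail_ge0 R N m.+1.
rewrite -natr1; move: (bin_tail R N m.+1) (bin_ratio R N m.+1) (bin_ratio R N m) => U r r' U0 r0.
move: (m%:R : R) (N%:R : R) => x n xn x0 E H.
rewrite -mulrA -E.
have D0 : 0 < n + 2 * (x + 1) ^+ 2 + (x + 1) by nra.
have {}H : (x + 1) * (n - (x + 1)) * r / (n + 2 * (x + 1) ^+ 2 + (x + 1)) <= U.
  by rewrite ler_pdivrMr.
apply: le_trans (_ : (r + (x + 1) * (n - (x + 1)) * r / (n + 2 * (x + 1) ^+ 2 + (x + 1))) *
   (n + 2 * x ^+ 2 + x) <= _); last by rewrite ler_wpM2r ?lerD2l //; nra.
rewrite -(ler_pM2r D0) [leRHS]mulrAC [(r + _) * _]mulrDl divfK ?gt_eqF //.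
have -> : x * ((n + x + 1) * r) * (n + 2 * (x + 1) ^+ 2 + (x + 1)) =
  r * (x * (n + x + 1) * (n + 2 * (x + 1) ^+ 2 + (x + 1))) by ring.
have -> : (r * (n + 2 * (x + 1) ^+ 2 + (x + 1)) + (x + 1) * (n - (x + 1)) * r) * (n + 2 * x ^+
  2 + x) =
  r * ((n + 2 * (x + 1) ^+ 2 + (x + 1) + (x + 1) * (n - (x + 1))) * (n + 2 * x ^+ 2 + x)) by ring.
rewrite ler_wpM2l // -subr_ge0.
have -> : (n + 2 * (x + 1) ^+ 2 + (x + 1) + (x + 1) * (n - (x + 1))) * (n + 2 * x ^+ 2 + x) -
  x * (n + x + 1) * (n + 2 * (x + 1) ^+ 2 + (x + 1)) = 2 * n ^+ 2 + n * (x + 2) - x * (x + 1)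
    by ring.
nra.
Qed.

(** The companion upper Mills bound, by the same downward induction from [k = N]; the index [k.-1]
    puts the term [bin_ratio R N k] itself into the tail. *)
Lemma bin_tail_pred_le (R : realType) (N k : nat) : (0 < k)%N -> (k <= N)%N ->
  2 * k%:R * bin_tail R N k.-1 <= (N%:R + k%:R) * bin_ratio R N k.
Proof.
move=> + kN; rewrite -(subKn kN); elim: (N - k)%N (leq_subr k N) => [|d IH] dN.
  rewrite subn0 => N_gt0; rewrite bin_tailS; last by lia.
  have -> : N.-1.+1 = N by lia.
  by rewrite /bin_tail subnn big_ord0 mul0r addr0 mulr_natl mulr2n.
set m := (N - d.+1)%N => m_gt0; have mN : (m < N)%N by rewrite /m; lia.
have := IH (ltnW dN); have -> : (N - d = m.+1)%N by rewrite /m; lia.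
move=> /(_ isT) /=; rewrite (@bin_tailS R N m.-1) ?prednK //; last by lia.
have := bin_ratioS R mN.
have : 0 < m%:R :> R by rewrite ltr0n.
have : m%:R + 1 <= N%:R :> R by rewrite natr1 ler_nat.
have := bin_ratio_ge0 R N m; have := bin_tail_ge0 R N m.
rewrite -[m.+1%:R]natr1; move: (bin_tail R N m) (bin_ratio R N m.+1) (bin_ratio R N m) => U r'
  r U0 r0.
move: (m%:R : R) (N%:R : R) => x n xn x0 E H.
have {E}H : 2 * (x + 1) * U <= (n - x) * r by rewrite -E -addrA.
rewrite -(ler_pM2r (_ : 0 < x + 1)); last by lra.
have : x * (2 * (x + 1) * U) <= x * ((n - x) * r) by rewrite ler_wpM2l // ltW.
have : 0 <= (n - x) * r by rewrite mulr_ge0 //; lra.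
by nra.
Qed.

(** Each factor [(N - m) / (N + m + 1)] is at least [exp (- (2m + 1) / (N - m))], and the odd
    numbers add up to [k^2]. Weakening [N - m] to [N - k] keeps the denominator fixed during the
    induction. *)
Lemma bin_ratio_ge (R : realType) (N k : nat) : (k < N)%N ->
  expR (- (k%:R ^+ 2 / (N%:R - k%:R))) <= bin_ratio R N k.
Proof.
move=> kN; have D0 : 0 < N%:R - k%:R :> R by rewrite subr_gt0 ltr_nat.
suff gen m : (m <= k)%N -> expR (- (m%:R ^+ 2 / (N%:R - k%:R))) <= bin_ratio R N m by exact: gen.
elim: m => [|m IH] mk; first by rewrite expr0n mul0r oppr0 expR0 bin_ratio0.
have mN : (m < N)%N by exact: ltn_trans kN.
have mN' : 0 < N%:R - m%:R :> R by rewrite subr_gt0 ltr_nat.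
have m0 : 0 <= m%:R :> R by rewrite ler0n.
have kR : m%:R + 1 <= k%:R :> R by rewrite natr1 ler_nat.
have -> : (m.+1%:R ^+ 2 / (N%:R - k%:R) : R) = m%:R ^+ 2 / (N%:R - k%:R) + (2 * m%:R + 1) /
  (N%:R - k%:R).
  by rewrite -natr1 -mulrDl; congr (_ / _); ring.
rewrite opprD expRD.
have E := bin_ratioS R mN.
have pos : 0 < N%:R + m%:R + 1 :> R by have : 0 <= N%:R :> R by []; lra.
rewrite -(ler_pM2l pos) E mulrCA.
have := IH (ltnW mk); have := expR_ge0 (- (m%:R ^+ 2 / (N%:R - k%:R)) : R).
set e := expR _; set e' := expR _ => e0 e_le.
have e'_le : (N%:R + m%:R + 1) * e' <= N%:R - m%:R.
  rewrite /e' expRN ler_pdivrMr ?expR_gt0 //.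
  apply: le_trans (_ : (N%:R - m%:R) * (1 + (2 * m%:R + 1) / (N%:R - k%:R)) <= _); last first.
    by rewrite ler_wpM2l ?expR_ge1Dx // ltW.
  rewrite mulrDr mulr1 -addrA -lerBlDl.
  have -> : N%:R + (m%:R + 1) - (N%:R - m%:R) = 2 * m%:R + 1 :> R by ring.
  rewrite mulrCA; apply: ler_peMr; first by rewrite addr_ge0 ?mulr_ge0.
  by rewrite ler_pdivlMr // mul1r lerD2l lerN2 ler_nat ltnW.
apply: le_trans (_ : e * (N%:R - m%:R) <= _); first by rewrite ler_wpM2l.
by rewrite mulrC ler_wpM2l // ltW.
Qed.

Lemma bin_ratio_le (R : realType) (N k : nat) : (k <= N)%N ->
  bin_ratio R N k <= expR (- (2 * k%:R ^+ 2 / (2 * N%:R + 1))).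
Proof.
elim: k => [|k IH] kN; first by rewrite expr0n mulr0 mul0r oppr0 expR0 bin_ratio0.
have D0 : 0 < 2 * N%:R + 1 :> R by have : 0 <= N%:R :> R by []; lra.
have kR : k%:R + 1 <= N%:R :> R by rewrite natr1 ler_nat.
have k0 : 0 <= k%:R :> R by rewrite ler0n.
pose y : R := (2 * k%:R + 1) / (2 * N%:R + 1).
have y0 : 0 <= y by rewrite divr_ge0 //; lra.
have -> : (2 * k.+1%:R ^+ 2 / (2 * N%:R + 1) : R) = 2 * k%:R ^+ 2 / (2 * N%:R + 1) + 2 * y.
  by rewrite /y -[k.+1%:R]natr1; field; rewrite gt_eqF.
rewrite opprD expRD.
have pos : 0 < N%:R + k%:R + 1 :> R by lra.
rewrite -(ler_pM2l pos) (bin_ratioS R kN).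
have le1 := subr1_le_expR y0.
have E1 : (1 - y) * ((2 * N%:R + 1) / 2) = N%:R - k%:R by rewrite /y; field; rewrite ?gt_eqF //.
have E2 : (1 + y) * ((2 * N%:R + 1) / 2) = N%:R + k%:R + 1 by rewrite /y; field;
  rewrite ?gt_eqF //.
have Nk0 : 0 <= N%:R - k%:R :> R by lra.
rewrite [leRHS]mulrCA [leLHS]mulrC.
apply: (ler_pM (bin_ratio_ge0 _ _ _) Nk0 (IH (ltnW kN))).
by rewrite -E1 -E2 mulrAC ler_wpM2r //; lra.
Qed.

(** * Decay and size of the gap counts *)

Lemma gap_countS_le_mul (N s x : nat) : (x < s < N)%N ->
  (gap_count N s x.+1 <= 2 * N * gap_count N s x)%N.
Proof.
move=> /andP[xs sN]; have xN : (x.+1 < N)%N by lia.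
have E := gap_count_ratio sN xN.
have D_gt0 : (0 < x.+1 * (2 * N - s - x - 2))%N by rewrite muln_gt0; lia.
rewrite -(leq_pmul2r D_gt0) E -mulnA [leqRHS]mulnCA leq_mul2l; apply/orP; right.
by rewrite [leqRHS]mulnA; apply: leq_mul; lia.
Qed.

Lemma gap_count_diag_le_mul (N s x : nat) : (x <= s < N)%N ->
  (gap_count N s s <= (2 * N) ^ (s - x) * gap_count N s x)%N.
Proof.
case/andP=> xs sN; rewrite -(subKn xs); move: (leq_subr x s).
elim: (s - x)%N => [|d IH] ds; first by rewrite subn0 subnn mul1n.
apply: leq_trans (IH (ltnW ds)) _; rewrite !subKn ?(ltnW ds) // expnSr -mulnA leq_mul2l.
have -> : (s - d = (s - d.+1).+1)%N by lia.
by rewrite gap_countS_le_mul ?orbT //; lia.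
Qed.

Lemma gap_countS_decay (R : realType) (N s y : nat) : (s <= y)%N -> (y.+1 < N)%N ->
  (gap_count N s y.+1)%:R <=
  (gap_count N s y)%:R * expR (- ((y - s)%:R / (2 * N%:R))) :> R.
Proof.
move=> sy yN; have sN : (s < N)%N by lia.
have := congr1 (fun n : nat => n%:R : R) (gap_count_ratio sN yN).
have D0 : 0 < (2 * N - s - y - 2)%:R :> R by rewrite ltr0n; lia.
rewrite !natrM; have D_gt0 : 0 < y.+1%:R * (2 * N - s - y - 2)%:R :> R by rewrite mulr_gt0 //
  ltr0Sn.
move=> E; rewrite -(ler_pM2r D_gt0) E -[leRHS]mulrA ler_wpM2l ?ler0n //.
apply: le_trans (_ : (1 - (y - s)%:R / (2 * N%:R)) * (y.+1%:R * (2 * N - s - y - 2)%:R) <= _);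
  last first.
  by rewrite ler_wpM2r ?(ltW D_gt0) // expR_ge1Dx.
have N0 : 0 < 2 * N%:R :> R by rewrite mulr_gt0 ?ltr0n //; lia.
rewrite -(ler_pM2r N0) [leRHS]mulrAC mulrBl mul1r divfK ?gt_eqF //.
have -> : (2 * N - s - y - 2)%:R = 2 * N%:R - s%:R - y%:R - 2 :> R.
  by rewrite -!subnDA natrB ?natrM ?natrD; [ring|lia].
have -> : (N - y.+1)%:R = N%:R - y%:R - 1 :> R by rewrite natrB ?(ltnW yN) // -natr1; ring.
rewrite natrB // !natrD -[y.+1%:R]natr1.
have : s%:R <= y%:R :> R by rewrite ler_nat.
have : y%:R + 2 <= N%:R :> R by rewrite -natrD ler_nat; lia.
have : 0 <= s%:R :> R by [].
move: (s%:R : R) (y%:R : R) (N%:R : R) => a b n a0 bn ab.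
rewrite -subr_ge0.
rewrite [leRHS](_ : _ = (b - a) * (2 * n ^+ 2 - (b + 1) * (2 * n - a - b - 2))); last by ring.
rewrite mulr_ge0 ?subr_ge0 // expr2 mulrA.
rewrite [leRHS]mulrC.
by apply: ler_pM; lra.
Qed.

Lemma gap_count_decay (R : realType) (N s d : nat) : (s + d < N)%N ->
  (gap_count N s (s + d))%:R <=
  (gap_count N s s)%:R * expR (- ((d * d.-1)%:R / (4 * N%:R))) :> R.
Proof.
elim: d => [|d IH] dN; first by rewrite addn0 mul0n mul0r oppr0 expR0 mulr1.
have N0 : N%:R != 0 :> R by rewrite pnatr_eq0; lia.
rewrite addnS; apply: (le_trans (gap_countS_decay _ _ _)); [exact: leq_addr|by rewrite -addnS|].
have sdN : (s + d < N)%N by apply: leq_trans dN; rewrite addnS.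
apply: le_trans (ler_wpM2r (expR_ge0 _) (IH sdN)) _.
rewrite -mulrA -expRD addKn ler_wpM2l ?ler0n // ler_expR.
suff -> : (d.+1 * d.+1.-1)%:R / (4 * N%:R) =
    (d * d.-1)%:R / (4 * N%:R) + d%:R / (2 * N%:R) :> R by rewrite opprD.
case: d {dN sdN IH} => [|d]; first by rewrite /= !(mul0r, muln0, mul0n) addr0.
by rewrite /= !natrM -[d.+2%:R]natr1 -[d.+1%:R]natr1; field.
Qed.

(** Left of the peak the crude ratio [2 N] per step costs only a logarithm, while right of it the
    decay is Gaussian. So a [j] at least as likely as [x] lies within about
    [sqrt (4 N (s - x) ln (2N))] of [s]. *)
Lemma swap_distance (R : realType) (N s x j : nat) :
  (x <= s)%N -> (s < j)%N -> (j < N)%N -> (gap_count N s x <= gap_count N s j)%N ->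
  ((j - s) * (j - s).-1)%:R <= 4 * N%:R * ((s - x)%:R * ln (2 * N%:R)) :> R.
Proof.
move=> xs sj jN le_gap; have sN : (s < N)%N := ltn_trans sj jN.
have N0 : 0 < N%:R :> R by rewrite ltr0n; lia.
have g0 : 0 < (gap_count N s s)%:R :> R by rewrite ltr0n gap_count_gt0.
have := @gap_count_decay R N s (j - s); rewrite subnKC ?(ltnW sj) // => /(_ jN).
set e := expR _ => decay.
have bound : (gap_count N s s)%:R <= (2 * N%:R) ^+ (s - x) * (gap_count N s j)%:R :> R.
  rewrite -natrM -natrX -natrM ler_nat.
  apply: leq_trans (_ : (2 * N) ^ (s - x) * gap_count N s x <= _)%N.
    by apply: gap_count_diag_le_mul; rewrite xs.
  by rewrite leq_mul2l le_gap orbT.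
have : (gap_count N s s)%:R <= (2 * N%:R) ^+ (s - x) * ((gap_count N s s)%:R * e) :> R.
  by apply: le_trans bound _; rewrite ler_wpM2l // exprn_ge0 // mulr_ge0 // ltW.
rewrite mulrCA -[leLHS]mulr1 ler_pM2l // /e expRN.
rewrite ler_pdivlMr ?expR_gt0 // mul1r.
have -> : (2 * N%:R) ^+ (s - x) = expR ((s - x)%:R * ln (2 * N%:R)) :> R.
  by rewrite expRM_natl lnK // posrE mulr_gt0.
by rewrite ler_expR ler_pdivrMr ?mulr_gt0 // mulrC.
Qed.

Lemma central_binS (M : nat) :
  (M.+1 * 'C(2 * M.+1, M.+1) = 2 * (2 * M + 1) * 'C(2 * M, M))%N.
Proof.
have -> : (2 * M.+1 = (2 * M + 1).+1)%N by lia.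
have := mul_bin_diag (2 * M + 1).+1 M; have := mul_bin_down (2 * M + 1) M.
have -> : (2 * M + 1 - M = M.+1)%N by lia.
have -> : ((2 * M + 1).-1 = 2 * M)%N by lia.
have -> : ((2 * M + 1).+1.-1 = 2 * M + 1)%N by lia.
by move=> F1 <-; rewrite -mulnA F1 mulnA; congr (_ * _)%N; lia.
Qed.

(** Squaring keeps the Wallis estimate free of roots. Since [16^M] is asymptotic to [pi M] times the
    squared central binomial, [2 M + 1] here and [4 N] below bracket the true factor. *)
Lemma central_bin_upper (R : realType) (M : nat) :
  ('C(2 * M, M))%:R ^+ 2 * (2 * M%:R + 1) <= 16 ^+ M :> R.
Proof.
elim: M => [|M IH]; first by rewrite muln0 bin0 expr0 expr1n; lra.
have := congr1 (fun n : nat => n%:R : R) (central_binS M).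
rewrite !natrM natrD natrM -[M.+1%:R]natr1 [16 ^+ M.+1]exprS.
have : 0 <= M%:R :> R by [].
move: IH; move: ('C(2 * M, M)%:R : R) ('C(2 * M.+1, M.+1)%:R : R) (16 ^+ M : R) (M%:R : R).
move=> c c' p m IH m0 E.
have m1 : 0 < (m + 1) ^+ 2 by rewrite exprn_gt0 //; lra.
rewrite -(ler_pM2r m1).
have -> : c' ^+ 2 * (2 * (m + 1) + 1) * (m + 1) ^+ 2 = ((m + 1) * c') ^+ 2 * (2 * m + 3) by ring.
rewrite E.
have -> : (2 * (2 * m + 1) * c) ^+ 2 * (2 * m + 3) = (c ^+ 2 * (2 * m + 1)) * (4 * (2 * m + 1)
  * (2 * m + 3)) by ring.
apply: le_trans (ler_wpM2r _ IH) _; first by rewrite !mulr_ge0 //; lra.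
have p0 : 0 <= p by apply: le_trans IH; rewrite mulr_ge0 ?sqr_ge0 //; lra.
rewrite [leRHS](_ : _ = p * (16 * (m + 1) ^+ 2)); last by ring.
by rewrite ler_wpM2l //; nra.
Qed.

Lemma central_bin_lower (R : realType) (N : nat) : (0 < N)%N ->
  16 ^+ N <= ('C(2 * N, N))%:R ^+ 2 * (4 * N%:R) :> R.
Proof.
case: N => // N _; elim: N => [|M IH]; first by rewrite muln1 bin1; lra.
have := congr1 (fun n : nat => n%:R : R) (central_binS M.+1).
rewrite !natrM natrD natrM -[M.+2%:R]natr1 [16 ^+ M.+2]exprS.
have : 1 <= M.+1%:R :> R by rewrite ler1n.
move: IH; move: ('C(2 * M.+1, M.+1)%:R : R) ('C(2 * M.+2, M.+2)%:R : R) (16 ^+ M.+1 : R)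
  (M.+1%:R : R).
move=> c c' p m IH m0 E.
have m1 : 0 < m + 1 by lra.
rewrite -(ler_pM2r m1).
have -> : c' ^+ 2 * (4 * (m + 1)) * (m + 1) = ((m + 1) * c') ^+ 2 * 4 by ring.
rewrite E.
have -> : (2 * (2 * m + 1) * c) ^+ 2 * 4 = c ^+ 2 * (16 * (2 * m + 1) ^+ 2) by ring.
apply: le_trans (_ : c ^+ 2 * (4 * m) * (16 * (m + 1)) <= _).
  rewrite [leLHS](_ : _ = p * (16 * (m + 1))); last by ring.
  by rewrite ler_wpM2r //; lra.
by rewrite -mulrA ler_wpM2l ?sqr_ge0 //; nra.
Qed.

Lemma bin_center_le (R : realType) (M h : nat) : (h <= M)%N ->
  ('C(2 * M, M - h))%:R ^+ 2 * (2 * M%:R + 1) <=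
  16 ^+ M * expR (- (4 * h%:R ^+ 2 / (2 * M%:R + 1))) :> R.
Proof.
move=> hM; have D0 : 0 <= 2 * M%:R + 1 :> R by rewrite addr_ge0 ?mulr_ge0.
have -> : ('C(2 * M, M - h))%:R = bin_ratio R M h * ('C(2 * M, M))%:R.
  by rewrite /bin_ratio divfK // gt_eqF // central_bin_gt0.
have -> : - (4 * h%:R ^+ 2 / (2 * M%:R + 1)) = 2%:R * - (2 * h%:R ^+ 2 / (2 * M%:R + 1)) :> R
  by ring.
rewrite expRM_natl exprMn -[leLHS]mulrA [leRHS]mulrC.
apply: ler_pM; [exact: sqr_ge0|by rewrite mulr_ge0 ?sqr_ge0| |exact: central_bin_upper].
by rewrite ler_sqr ?nnegrE ?bin_ratio_ge0 ?expR_ge0 // bin_ratio_le.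
Qed.

(* The variance of the walk is largest in the middle, so the bound obtained at
   the two ends of the gap is weakest there; the exponent must be at least [1]
   for the Gaussian factor to dominate the factor [1 / sqrt]. *)
Lemma gap_count_upper (R : realType) (N s k : nat) (h := uphalf k) :
  (k <= s)%N -> (s < N)%N -> N%:R + 1 <= 8 * h%:R ^+ 2 :> R ->
  ((gap_count N s (s - k))%:R / ('C(2 * N, N))%:R) ^+ 2 <=
  4 / N%:R * expR (- (8 * h%:R ^+ 2 / (N%:R + 1))) :> R.
Proof.
move=> ks sN h_large; have N_gt0 : (0 < N)%N by lia.
have hk : (k <= 2 * h <= k.+1)%N.
  by rewrite /h uphalf_half; have := odd_double_half k; lia.
set M1 := (s.+1 - h)%N; set M2 := (N - M1)%N.
have hM1 : (h <= M1)%N by rewrite /M1; lia.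
have hM2 : (h <= M2)%N by rewrite /M2 /M1; lia.
have b1 := bin_center_le R hM1; have b2 := bin_center_le R hM2.
have M12 : M1%:R + M2%:R = N%:R :> R by rewrite -natrD; congr (_%:R); rewrite /M2 /M1; lia.
have pow16 : 16 ^+ M1 * 16 ^+ M2 = 16 ^+ N :> R.
  by rewrite -exprD; congr (_ ^+ _); rewrite /M2 /M1; lia.
have low := central_bin_lower R N_gt0.
have gap_le : (gap_count N s (s - k))%:R <= ('C(2 * M1, M1 - h))%:R * ('C(2 * M2, M2 - h))%:R
  :> R.
  rewrite -natrM ler_nat; have := gap_count_le_central ks sN.
  rewrite -/h -/M1 -/M2; have -> : (N - s.+1 = M2 - h)%N by rewrite /M2 /M1; lia.
  suff -> : 'C(2 * M1, s.+1) = 'C(2 * M1, M1 - h) by [].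
  by rewrite -bin_sub; [congr 'C(_, _)|]; rewrite /M1; lia.
have c0 := central_bin_gt0 R N.
have m1 : 0 <= M1%:R :> R by []; have m2 : 0 <= M2%:R :> R by [].
have n0 : 0 < N%:R :> R by rewrite ltr0n.
have g0 : 0 <= (gap_count N s (s - k))%:R :> R by [].
pose Z1 : R := 2 * M1%:R + 1; pose Z2 : R := 2 * M2%:R + 1; pose a : R := h%:R ^+ 2.
pose e1 := expR (- (4 * a / Z1)); pose e2 := expR (- (4 * a / Z2)).
rewrite -/Z1 -/a -/e1 in b1; rewrite -/Z2 -/a -/e2 in b2.
move: gap_le b1 b2 low c0 g0 h_large pow16.
move: (16 ^+ N : R) (16 ^+ M1 : R) (16 ^+ M2 : R) => p p1 p2.
move: (('C(2 * M1, M1 - h))%:R : R) (('C(2 * M2, M2 - h))%:R : R) (('C(2 * N, N))%:R : R)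
  ((gap_count N s (s - k))%:R : R).
move=> c1 c2 c g gap_le b1 b2 low c0 g0 h_large pow16.
rewrite -/a in h_large *; set n := N%:R in M12 n0 h_large low *.
have Z1p : 0 < Z1 by rewrite /Z1; lra.
have Z2p : 0 < Z2 by rewrite /Z2; lra.
have ZZ : Z1 * Z2 <= (n + 1) ^+ 2.
  rewrite -subr_ge0 [leRHS](_ : _ = (M1%:R - M2%:R) ^+ 2) ?sqr_ge0 //.
  by rewrite /Z1 /Z2 -M12; ring.
pose c_ := 8 * a / (n + 1); pose v := (n + 1) ^+ 2 / (Z1 * Z2).
have n1 : 0 < n + 1 by lra.
have cge1 : 1 <= c_ by rewrite ler_pdivlMr // mul1r.
have v1 : 1 <= v by rewrite ler_pdivlMr ?mulr_gt0 // mul1r.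
(* Since [Z1 + Z2 = 2 (n + 1)], the two exponents add up to [c_ * v]. *)
have e12 : e1 * e2 = expR (- (c_ * v)).
  rewrite -expRD; congr expR; rewrite /c_ /v.
  have -> : n = (Z1 + Z2) / 2 - 1 by rewrite /Z1 /Z2 -M12; field.
  by field; rewrite ?gt_eqF //; lra.
have ve : v * expR (- (c_ * v)) <= expR (- c_).
  have -> : - c_ = - (c_ * v) + c_ * (v - 1) by ring.
  rewrite expRD mulrC ler_wpM2l ?expR_ge0 //.
  apply: le_trans (_ : expR (v - 1) <= _); last by rewrite ler_expR ler_peMl ?subr_ge0.
  by have := expR_ge1Dx (v - 1); lra.
have main : g ^+ 2 * (Z1 * Z2) <= p * (e1 * e2).
  apply: le_trans (_ : (c1 * c2) ^+ 2 * (Z1 * Z2) <= _).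
    apply: ler_wpM2r; first by rewrite mulr_ge0 ?ltW.
    by rewrite ler_sqr ?nnegrE // (le_trans g0).
  rewrite -pow16 exprMn mulrACA [leRHS]mulrACA.
  by apply: ler_pM => //; apply: mulr_ge0; rewrite ?sqr_ge0 ?ltW.
rewrite expr_div_n ler_pdivrMr ?exprn_gt0 //.
rewrite -(ler_pM2r (mulr_gt0 Z1p Z2p)); apply: le_trans main _.
apply: le_trans (_ : c ^+ 2 * (4 * n) * (e1 * e2) <= _).
  by rewrite ler_wpM2r // mulr_ge0 ?expR_ge0.
rewrite e12 -/c_.
apply: le_trans (_ : c ^+ 2 * 4 * n / v * expR (- c_) <= _).
  rewrite -[leLHS]mulr1 -[X in _ * X <= _](@mulVf _ v); last by rewrite gt_eqF //; lra.
  rewrite [leLHS](_ : _ = c ^+ 2 * 4 * n / v * (v * expR (- (c_ * v)))); last by ring.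
  by rewrite ler_wpM2l // !mulr_ge0 ?sqr_ge0 ?invr_ge0 //; lra.
rewrite [leRHS](_ : _ = (4 / n * c ^+ 2 * (Z1 * Z2)) * expR (- c_)); last by ring.
rewrite ler_wpM2r ?expR_ge0 // /v.
rewrite [leLHS](_ : _ = (4 * c ^+ 2 * (Z1 * Z2) / n) * (n / (n + 1)) ^+ 2); last first.
  by field; rewrite ?gt_eqF.
rewrite [leRHS](_ : _ = (4 * c ^+ 2 * (Z1 * Z2) / n)); last by ring.
have frac : 0 <= n / (n + 1) <= 1.
  by rewrite divr_ge0 ?(ltW n0) ?(ltW n1) //= ler_pdivrMr // mul1r; lra.
rewrite ler_piMr ?exprn_ile1 //; case/andP: frac => // _ _.
by rewrite divr_ge0 ?(ltW n0) // mulr_ge0 ?(ltW (mulr_gt0 Z1p Z2p)) // mulr_ge0 ?sqr_ge0.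
Qed.

(** * Where the tail crosses 1: for [N > 400], and asymptotically *)

Lemma sqr_ge (R : realType) (b a x : R) : 0 <= a -> a <= x -> b <= a * a -> b <= x ^+ 2.
Proof. by move=> a0 ax /le_trans; apply; rewrite expr2; apply: ler_pM. Qed.

(** Five squarings of the linear bound at [31 / 640], rounded down to small fractions. The target
    4.47 lies just below [401^(1/4)]. *)
Lemma le_expR_155 (R : realType) : 447 / 100 <= expR (155 / 100) :> R.
Proof.
have -> : 155 / 100 = 32%:R * (31 / 640) :> R by field.
rewrite expRM_natl; set x := expR _.
have e1 : 65 / 62 <= x by apply: le_trans (expR_ge1Dx _); lra.
have e2 : 122 / 111 <= x ^+ 2 by apply: sqr_ge e1 _; clear; lra.
have e4 : 151 / 125 <= x ^+ 4 by rewrite (exprM _ 2 2); apply: sqr_ge e2 _; clear; lra.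
have e8 : 143 / 98 <= x ^+ 8 by rewrite (exprM _ 4 2); apply: sqr_ge e4 _; clear; lra.
have e16 : 66 / 31 <= x ^+ 16 by rewrite (exprM _ 8 2); apply: sqr_ge e8 _; clear; lra.
by rewrite (exprM _ 16 2); apply: sqr_ge e16 _; clear; lra.
Qed.

Lemma expR_145_le (R : realType) : expR (145 / 100) <= 447 / 100 :> R.
Proof.
suff : 1 <= 447 / 100 * expR (- (145 / 100)) :> R by rewrite expRN ler_pdivlMr ?expR_gt0 ?mul1r.
have -> : - (145 / 100) = 32%:R * (- (29 / 640)) :> R by field.
rewrite expRM_natl; set x := expR _.
have e1 : 21 / 22 <= x by apply: le_trans (expR_ge1Dx _); lra.
have e2 : 41 / 45 <= x ^+ 2 by apply: sqr_ge e1 _; clear; lra.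
have e4 : 83 / 100 <= x ^+ 4 by rewrite (exprM _ 2 2); apply: sqr_ge e2 _; clear; lra.
have e8 : 31 / 45 <= x ^+ 8 by rewrite (exprM _ 4 2); apply: sqr_ge e4 _; clear; lra.
have e16 : 9 / 19 <= x ^+ 16 by rewrite (exprM _ 8 2); apply: sqr_ge e8 _; clear; lra.
have e32 : 100 / 447 <= x ^+ 32 by rewrite (exprM _ 16 2); apply: sqr_ge e16 _; clear; lra.
by move: e32; move: (x ^+ 32) => y; clear; lra.
Qed.

(** At [k^2 = N L / 4] and [N L / 2] the factor [exp (- k^2 / N)] is [1 / z] and [1 / z^2], so both
    crossings become inequalities between [z] and [L]. The last bound uses the tangent of [exp] at
    1.55, whose slope gives [4 / 4.47 < 179 / 200]. *)
Lemma fourth_root_ln (R : realType) (N : nat) (L := ln N%:R : R) (z := expR (L / 4)) :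
  (400 < N)%N ->
  [/\ z ^+ 4 = N%:R, 447 / 100 <= z, 58 / 10 <= L & L <= 22 / 10 + 179 / 200 * z].
Proof.
move=> N400; have N0 : 0 < N%:R :> R by rewrite ltr0n; lia.
have N401 : 401 <= N%:R :> R by rewrite ler_nat.
have z4 : z ^+ 4 = N%:R.
  by rewrite /z -expRM_natl mulrC divfK ?lnK ?posrE // gt_eqF.
have z0 : 0 <= z := expR_ge0 _.
have zge : 447 / 100 <= z.
  rewrite leNgt; apply/negP => zlt; suff : z ^+ 4 < 401 by rewrite z4 ltNge N401.
  rewrite (exprM _ 2 2); have z2 : z ^+ 2 <= 20 by rewrite expr2; nra.
  by have := sqr_ge0 z; rewrite [X in X < _]expr2; nra.
have Lge : 145 / 100 <= L / 4.
  by rewrite -ler_expR; apply: le_trans (expR_145_le R) zge.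
split=> //; first by lra.
have := expR_ge1Dx (L / 4 - 155 / 100); rewrite expRB ler_pdivlMr ?expR_gt0 // -/z.
have := le_expR_155 R.
have [|] := leP (22 / 10) L => hL; last by lra.
nra.
Qed.

Lemma bin_tail_gt1 (R : realType) (N k : nat) : (400 < N)%N ->
  k%:R ^+ 2 <= N%:R * ln N%:R / 4 :> R -> 1 < bin_tail R N k.
Proof.
move=> N400 k_small; have := @fourth_root_ln R N N400.
set L := ln _ in k_small *; set z := expR _ => -[z4 z447 L58 Lle].
have N0 : 0 < N%:R :> R by rewrite ltr0n; lia.
set n := N%:R in k_small z4 N0.
pose a := Num.sqrt (n * L / 4).
have rad0 : 0 <= n * L / 4 by rewrite divr_ge0 // mulr_ge0 ?ltW //; lra.
have a2 : a ^+ 2 = n * L / 4 by rewrite sqr_sqrtr.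
have a0 : 0 <= a := sqrtr_ge0 _.
(* The tail decreases in [k], so only the largest admissible index matters. *)
pose K := Num.truncn a; have /andP[Ka aK] := truncn_itv a0; rewrite -/K in Ka aK.
have kK : (k <= K)%N.
  rewrite -ltnS -(ltr_nat R); apply: le_lt_trans aK.
  by move: k_small; rewrite -a2 ler_sqr ?nnegrE.
apply: lt_le_trans (bin_tail_le R N kK).
have zp : 0 < z := expR_gt0 _.
have z2n : n = z ^+ 2 * z ^+ 2 by rewrite -z4 -exprD.
have z2_ge : 1998 / 100 <= z ^+ 2 by rewrite expr2; clear -z447; nra.
have n_ge : 89 * z <= n by rewrite z2n; clear -z447 z2_ge; nra.
have n_ge' : 399 <= n by rewrite z2n; clear -z2_ge; nra.
have a_ge : 12 / 10 * z ^+ 2 <= a.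
  have lo0 : 0 <= 12 / 10 * z ^+ 2 by rewrite mulr_ge0 ?sqr_ge0.
  suff : (12 / 10 * z ^+ 2) ^+ 2 <= a ^+ 2 by rewrite ler_sqr ?nnegrE.
  by rewrite a2 exprMn [(z ^+ 2) ^+ 2]expr2 -z2n; clear -L58 N0; nra.
pose d := a / n.
have dn : a = d * n by rewrite divfK ?gt_eqF.
have d0 : 0 <= d by rewrite divr_ge0 // ltW.
have d2 : d ^+ 2 * n = L / 4.
  by apply: (mulIf (lt0r_neq0 N0)); rewrite [RHS]mulrC mulrA -a2 dn; ring.
have d_le : d <= 8 / 125.
  rewrite leNgt; apply/negP => dgt.
  have dd : 8 / 125 * (8 / 125) <= d ^+ 2.
    by rewrite expr2; apply: ler_pM (ltW dgt) (ltW dgt); clear; lra.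
  have : 8 / 125 * (8 / 125) * n <= L / 4 by rewrite -d2 ler_wpM2r // ltW.
  by move: n_ge Lle z447; clear; lra.
have Lz : L <= 139 / 100 * z by move: Lle z447; clear; lra.
have L0 : 0 <= L by move: L58; clear; lra.
have Ld0 : 0 <= L * d by exact: mulr_ge0.
have Ld : L * d <= 39 / 100.
  rewrite leNgt; apply/negP => Ldgt.
  have sq : 39 / 100 * (39 / 100) <= (L * d) ^+ 2.
    by rewrite expr2; apply: ler_pM (ltW Ldgt) (ltW Ldgt); clear; lra.
  have L3 : L ^+ 3 <= (139 / 100 * z) ^+ 3 by rewrite lerXn2r ?nnegrE //; apply: le_trans Lz.
  have n3 : 447 / 100 * z ^+ 3 <= n by rewrite -z4 [z ^+ 4]exprS;
    exact: (ler_wpM2r (exprn_ge0 3 (ltW zp)) z447).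
  have : 39 / 100 * (39 / 100) * n <= L ^+ 3 / 4.
    rewrite [leRHS](_ : _ = (L * d) ^+ 2 * n); first by rewrite ler_wpM2r // ltW.
    by rewrite [in RHS]exprMn -[RHS]mulrA d2 mulrA -exprSr.
  have : 0 < z ^+ 3 by rewrite exprn_gt0.
  by rewrite exprMn in L3; move: L3 n3; move: (z ^+ 3) (L ^+ 3) => z3 l3; clear; lra.
have an : a <= n / 4 by rewrite dn [n / 4]mulrC ler_wpM2r ?(ltW N0) //; move: d_le; clear; lra.
have Kn : K%:R < n by apply: le_lt_trans Ka _; move: an N0; clear; lra.
have KN : (K < N)%N by rewrite -(ltr_nat R).
have K0 : 0 < K%:R :> R.
  have : 1 < K.+1%:R :> R by apply: le_lt_trans aK; move: a_ge z2_ge; clear; lra.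
  by rewrite -natr1; clear; lra.
(* Compared with [L / 4] the exponent grows by at most [21 / 200], thanks to the bounds on [d] and
   [L * d]; and [179 / 200 = 1 - 21 / 200]. *)
have r_ge : 179 / 200 / z <= bin_ratio R N K.
  apply: le_trans (bin_ratio_ge R KN); rewrite -/n.
  have -> : 179 / 200 / z = 179 / 200 * expR (- (L / 4)) by rewrite expRN.
  apply: le_trans (_ : expR (- (21 / 200)) * expR (- (L / 4)) <= _).
    rewrite ler_wpM2r ?expR_ge0 //; apply: le_trans (expR_ge1Dx _); clear; lra.
  rewrite -expRD ler_expR -opprD lerN2 ler_pdivrMr ?subr_gt0 //.
  apply: le_trans (_ : n * L / 4 <= _); first by rewrite -a2 lerXn2r ?nnegrE ?ler0n.
  apply: le_trans (_ : (21 / 200 + L / 4) * (n - a) <= _); last first.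
    by rewrite ler_wpM2l ?lerD2l ?lerN2 //; move: L0; clear; lra.
  rewrite [n - a](_ : _ = n * (1 - d)); last by rewrite [in LHS]dn; ring.
  rewrite [leRHS]mulrCA -[leLHS]mulrA ler_wpM2l ?(ltW N0) //; move: Ld d_le.
  rewrite [X in _ -> _ -> _ <= X](_ : _ = 21 / 200 + L / 4 - 21 / 200 * d - L * d / 4);
    last by ring.
  by clear; lra.
rewrite ltNge; apply/negP => tail_le.
have := bin_tail_ge R (ltnW KN); rewrite -/n => tail_ge.
have D0 : 0 <= n + 2 * K%:R ^+ 2 + K%:R.
  by rewrite !addr_ge0 ?mulr_ge0 ?sqr_ge0 ?(ltW N0).
have {tail_ge tail_le}H : K%:R * (n - K%:R) * bin_ratio R N K <= n + 2 * K%:R ^+ 2 + K%:R.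
  by apply: le_trans tail_ge _; rewrite ler_piMl.
have r0 := bin_ratio_ge0 R N K.
rewrite -natr1 in aK.
move: (bin_ratio R N K) (K%:R : R) H r_ge r0 K0 Kn Ka aK D0 => r x H r_ge r0 x0 xn xa ax D0.
(* The truncation [x] is replaced by [a]: [n / t + 2 t + 1] is no larger at [t = x] than at [t = a],
   because [n <= 2 a x]. *)
have {}H : a * (n - x) * r <= n + 2 * a ^+ 2 + a.
  rewrite -(ler_pM2l x0).
  apply: le_trans (_ : a * (n + 2 * x ^+ 2 + x) <= _).
    rewrite [leLHS](_ : _ = a * (x * (n - x) * r)); last by ring.
    by rewrite ler_wpM2l.
  rewrite -subr_ge0 [leRHS](_ : _ = (a - x) * (2 * a * x - n)); last by ring.
  rewrite mulr_ge0 ?subr_ge0 //.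
  suff : n <= 2 * a * (a - 1) by move/le_trans; apply; rewrite ler_wpM2l ?mulr_ge0 //;
    move: ax; clear; lra.
  rewrite [leRHS](_ : _ = 2 * a ^+ 2 - 2 * a); last by ring.
  have nL : 58 / 10 * n <= n * L by rewrite mulrC ler_wpM2l ?(ltW N0).
  by rewrite a2; move: nL an N0; clear; lra.
have {}H : a * (n * (117 / 125)) * (179 / 200 / z) <= n + 2 * a ^+ 2 + a.
  apply: le_trans H; apply: ler_pM => //.
  - by rewrite !mulr_ge0 ?(ltW N0) //; clear; lra.
  - by rewrite !mulr_ge0 ?invr_ge0 ?(ltW zp) //; clear; lra.
  rewrite ler_wpM2l //; apply: le_trans (_ : n - a <= _); last by move: xa; clear; lra.
  by rewrite dn; move: (ler_wpM2r (ltW N0) d_le); clear; lra.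
(* Up to a factor [z] this says about [1.005 z <= 1.064 + L / 2], which the linear bound on [L]
   refutes for [z >= 4.47]. *)
have : 12 / 10 * z ^+ 2 * (117 / 125 * (179 / 200)) <= (1 + L / 2 + 8 / 125) * z.
  apply: le_trans (_ : a * (117 / 125 * (179 / 200)) <= _).
    by rewrite ler_wpM2r //; clear; lra.
  rewrite -ler_pdivrMr // -(ler_pM2r N0).
  rewrite [leLHS](_ : _ = a * (n * (117 / 125)) * (179 / 200 / z)); last by ring.
  apply: le_trans H _; rewrite a2 [in leLHS]dn.
  rewrite [leRHS](_ : _ = n + n * L / 2 + 8 / 125 * n); last by ring.
  by move: (ler_wpM2r (ltW N0) d_le); clear; lra.
rewrite expr2 !mulrA -subr_ge0 [X in 0 <= X](_ : _ = (1 + L / 2 + 8 / 125 - 12 / 10 * z * (117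
  / 125 * (179 / 200))) * z); last by ring.
rewrite pmulr_lge0 //; move: Lle z447; clear; lra.
Qed.

Lemma bin_tail_lt_half (R : realType) (N k : nat) : (400 < N)%N -> (0 < k <= N)%N ->
  N%:R * ln N%:R / 2 <= k%:R ^+ 2 :> R -> 2 * bin_tail R N k.-1 < 1.
Proof.
move=> N400 /andP[k_gt0 kN] k_large; have := @fourth_root_ln R N N400.
set L := ln _ in k_large *; set z := expR _ => -[z4 z447 L58 Lle].
have N0 : 0 < N%:R :> R by rewrite ltr0n; lia.
have k0 : 0 < k%:R :> R by rewrite ltr0n.
have kn : k%:R <= N%:R :> R by rewrite ler_nat.
have tail := bin_tail_pred_le R k_gt0 kN; have r_le := bin_ratio_le R kN.
have r0 := bin_ratio_ge0 R N k.
move: (bin_ratio R N k) (bin_tail R N k.-1) tail r_le r0 => r U tail r_le r0.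
move: (k%:R : R) k0 kn k_large tail r_le => x x0 xn k_large tail r_le.
set n := N%:R in k_large z4 N0 xn tail r_le.
have zp : 0 < z := expR_gt0 _.
have z2p : 0 < z ^+ 2 by rewrite exprn_gt0.
have z2n : n = z ^+ 2 * z ^+ 2 by rewrite -z4 -exprD.
have z2_ge : 19 <= z ^+ 2 by rewrite expr2; clear -z447; nra.
have n_ge : 84 * z <= n.
  rewrite z2n; apply: le_trans (ler_wpM2r (ltW z2p) z2_ge).
  have : 447 / 100 * z <= z ^+ 2 by rewrite expr2 ler_wpM2r ?(ltW zp).
  by move: zp; clear; lra.
have x_ge : 17 / 10 * z ^+ 2 <= x.
  have lo0 : 0 <= 17 / 10 * z ^+ 2 by rewrite mulr_ge0 ?sqr_ge0 //; clear; lra.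
  suff : (17 / 10 * z ^+ 2) ^+ 2 <= x ^+ 2 by rewrite ler_sqr ?nnegrE ?(ltW x0).
  apply: le_trans k_large; rewrite exprMn [(z ^+ 2) ^+ 2]expr2 -z2n expr2.
  have : 58 / 10 * n <= n * L by rewrite mulrC ler_wpM2l ?(ltW N0).
  by move: N0; clear; lra.
have {}r_le : r <= 100 / 99 / z ^+ 2.
  apply: le_trans r_le _.
  have -> : 100 / 99 / z ^+ 2 = 100 / 99 * expR (- (L / 2)).
    by rewrite -expRM_natl -expRN; congr (_ * expR _); field.
  apply: le_trans (_ : expR (1 / 100) * expR (- (L / 2)) <= _); last first.
    rewrite ler_wpM2r ?expR_ge0 //.
    suff : 1 <= 100 / 99 * expR (- (1 / 100)) :> R by rewrite expRN ler_pdivlMr ?expR_gt0 ?mul1r.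
    by have := expR_ge1Dx (- (1 / 100) : R); clear; lra.
  rewrite -expRD ler_expR lerNl.
  have n1 : 0 < 2 * n + 1 by move: N0; clear; lra.
  rewrite ler_pdivlMr //; apply: le_trans (_ : n * L <= _); last by move: k_large; clear; lra.
  rewrite [leLHS](_ : _ = n * L - n / 50 - 1 / 100 + L / 2); last by field.
  by move: Lle z447 n_ge; clear; lra.
(* Together with [r <= 1 / 10] this turns the upper Mills bound into [2 U <= 7 / 10]. *)
have nr : n * r <= 3 / 5 * x.
  apply: le_trans (ler_wpM2l (ltW N0) r_le) _.
  rewrite {1}z2n [leLHS](_ : _ = 100 / 99 * z ^+ 2); last by field; rewrite gt_eqF.
  by move: x_ge x0; clear; lra.
have r_small : r <= 1 / 10.
  apply: le_trans r_le _; rewrite ler_pdivrMr //; move: z2_ge; clear; lra.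
rewrite -(ltr_pM2r x0) mul1r.
have -> : 2 * U * x = 2 * x * U by ring.
apply: le_lt_trans tail _; rewrite mulrDl.
have : x * r <= x * (1 / 10) by rewrite ler_wpM2l ?(ltW x0).
by move: nr x0; clear; lra.
Qed.

Lemma ln_nat_large (R : realType) (x : R) :
  exists N0 : nat, forall N : nat, (N0 <= N)%N -> (1 <= N)%N /\ x <= ln N%:R.
Proof.
exists (Num.truncn (expR x)).+1 => N N0N; have N_gt0 : (1 <= N)%N by exact: leq_trans N0N.
split=> //; rewrite -ler_expR lnK ?posrE ?ltr0n //.
have /andP[_ /ltW/le_trans] := truncn_itv (expR_ge0 x); apply.
by rewrite ler_nat.
Qed.

Lemma bin_tail_gt1_near (R : realType) (c : R) : 0 < c < 1 / 2 ->
  exists N0 : nat, forall N k : nat, (N0 <= N)%N ->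
    k%:R ^+ 2 <= c * (N%:R * ln N%:R) -> 1 < bin_tail R N k.
Proof.
case/andP=> c0 c2; pose del := 1 - 2 * c.
have del0 : 0 < del by rewrite /del; lra.
(* [1024] is the square of the 32 in the final contradiction. The summands of the threshold below
   provide [L^3 <= n], [4 <= c L] and the growth bound [grow], which is where [c < 1/2] enters. *)
pose c3 := 1024%:R : R.
have [N0 N0P] := ln_nat_large (24 + 4 / c + 2 * c3 / del ^+ 2).
exists N0 => N k N0N k_small; have [N_gt0 L_large] := N0P N N0N.
have NR : 0 < N%:R :> R by rewrite ltr0n.
have c30 : 0 < c3 by rewrite /c3 ltr0n.
have X0 : 0 <= 2 * c3 / del ^+ 2 by rewrite divr_ge0 ?sqr_ge0 // mulr_ge0 // ltW.
have C0 : 0 <= 4 / c by rewrite divr_ge0 // ltW.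
have Lc : 4 <= c * ln N%:R.
  rewrite mulrC -ler_pdivrMr //; move: L_large X0 C0.
  by move: (4 / c) (2 * c3 / del ^+ 2) (ln _) => u v w; clear; lra.
have L24 : 24 <= ln N%:R :> R.
  move: L_large X0 C0; move: (4 / c) (2 * c3 / del ^+ 2) (ln _) => u v w; clear; lra.
have Ld : 2 * c3 <= ln N%:R * del ^+ 2.
  rewrite -ler_pdivrMr ?exprn_gt0 //; move: L_large X0 C0.
  by move: (4 / c) (2 * c3 / del ^+ 2) (ln _) => u v w; clear; lra.
have nE : expR (ln N%:R) = N%:R :> R by rewrite lnK ?posrE.
set L := ln _ in k_small L_large Lc L24 Ld nE.
set n := N%:R in k_small NR nE.
have L0 : 0 < L by move: L24; clear; lra.
have L3n : L ^+ 3 <= n.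
  rewrite -nE; apply: le_trans (expR_ge1Dxn 3 (ltW L0)).
  have -> : 4`!%:R = 24 :> R by [].
  apply: le_trans (_ : L ^+ 4 / 24 <= _); last by clear; lra.
  rewrite ler_pdivlMr // [leRHS]exprSr ler_wpM2l // exprn_ge0 // ltW //.
have grow : c3 * L <= n * expR (- (2 * c * L)).
  rewrite -nE -expRD; have -> : L + - (2 * c * L) = del * L by rewrite /del; ring.
  apply: le_trans (expR_ge1Dxn 1 (mulr_ge0 (ltW del0) (ltW L0))).
  have -> : 2`!%:R = 2 :> R by [].
  apply: le_trans (_ : (del * L) ^+ 2 / 2 <= _); last by clear; lra.
  rewrite ler_pdivlMr // mulrAC exprMn [L ^+ 2]expr2 mulrA.
  by rewrite ler_wpM2r ?(ltW L0) // mulrC [_ ^+ 2 * _]mulrC.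
have rad0 : 0 <= c * (n * L) by rewrite !mulr_ge0 ?ltW.
pose a := Num.sqrt (c * (n * L)); have a2 : a ^+ 2 = c * (n * L) by rewrite sqr_sqrtr.
have a0 : 0 <= a := sqrtr_ge0 _.
pose K := Num.truncn a; have /andP[Ka aK] := truncn_itv a0; rewrite -/K -[K.+1%:R]natr1 in Ka aK.
have kK : (k <= K)%N.
  rewrite -ltnS -(ltr_nat R) -[K.+1%:R]natr1; apply: le_lt_trans aK.
  by move: k_small; rewrite -a2 ler_sqr ?nnegrE.
apply: lt_le_trans (bin_tail_le R N kK).
have a2n : 4 * n <= a ^+ 2 by rewrite a2 mulrCA [leRHS]mulrC ler_wpM2r ?(ltW NR).
have n24 : 24 <= n by rewrite -nE; apply: le_trans (expR_ge1Dx _); move: L24; clear; lra.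
have a4 : 4 <= a.
  have : 4 ^+ 2 <= a ^+ 2 by apply: le_trans a2n; rewrite expr2; move: n24; clear; lra.
  by rewrite ler_sqr ?nnegrE.
have K0 : 0 < K%:R :> R by move: aK a4; clear; lra.
have aK2 : a <= 2 * K%:R by move: aK a4; clear; lra.
have K2n : n <= K%:R ^+ 2.
  have : a ^+ 2 <= (2 * K%:R) ^+ 2 by rewrite ler_sqr ?nnegrE // mulr_ge0 // ltW.
  by rewrite exprMn; move: a2n; rewrite [2 ^+ 2]expr2; clear; lra.
have acL : a * (c * L + 1) <= n.
  have cL0 : 0 <= c * L + 1 by move: Lc; clear; lra.
  have : (a * (c * L + 1)) ^+ 2 <= n ^+ 2.
    rewrite exprMn a2; apply: le_trans (_ : n * L * L ^+ 2 <= _); last first.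
      by rewrite -mulrA -exprS [leRHS]expr2 ler_wpM2l // ltW.
    apply: ler_pM; rewrite ?sqr_ge0 //.
      by rewrite ler_piMl ?mulr_ge0 ?(ltW NR) ?(ltW L0) //; move: c2; clear; lra.
    rewrite ler_sqr ?nnegrE ?(ltW L0) //.
    have : c * L <= 1 / 2 * L by rewrite ler_wpM2r ?(ltW L0) // ltW.
    by move: L24; clear; lra.
  by rewrite ler_sqr ?nnegrE ?mulr_ge0 ?(ltW NR).
have an : 5 * a <= n.
  apply: le_trans acL; rewrite mulrC ler_wpM2l //; move: Lc; clear; lra.
have Kn : K%:R < n by move: Ka an a4; clear; lra.
have KN : (K < N)%N by rewrite -(ltr_nat R).
have r_ge : expR (- (c * L)) / 4 <= bin_ratio R N K.
  apply: le_trans (bin_ratio_ge R KN); rewrite -/n.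
  apply: le_trans (_ : expR (- (c * L)) * expR (- 1) <= _).
    rewrite ler_wpM2l ?expR_ge0 //.
    have -> : - 1 = 2%:R * (- (1 / 2)) :> R by field.
    rewrite expRM_natl; apply: (@sqr_ge _ _ (1 / 2)); [by clear; lra| |by clear; lra].
    by apply: le_trans (expR_ge1Dx _); clear; lra.
  rewrite -expRD ler_expR -opprD lerN2 ler_pdivrMr ?subr_gt0 //.
  apply: le_trans (_ : a ^+ 2 <= _); first by rewrite lerXn2r ?nnegrE ?ler0n.
  apply: le_trans (_ : (c * L + 1) * (n - a) <= _); last first.
    by rewrite ler_wpM2l ?lerD2l ?lerN2 //; move: Lc; clear; lra.
  rewrite a2 [leRHS](_ : _ = c * (n * L) + n - a * (c * L + 1)); last by ring.
  by move: acL; clear; lra.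
rewrite ltNge; apply/negP => tail_le.
have := bin_tail_ge R (ltnW KN); rewrite -/n => tail_ge.
have D0 : 0 <= n + 2 * K%:R ^+ 2 + K%:R.
  by rewrite !addr_ge0 ?mulr_ge0 ?sqr_ge0 ?(ltW NR).
have {tail_ge tail_le}H : K%:R * (n - K%:R) * bin_ratio R N K <= n + 2 * K%:R ^+ 2 + K%:R.
  by apply: le_trans tail_ge _; rewrite ler_piMl.
have KK : K%:R <= K%:R ^+ 2 :> R.
  by rewrite -[leLHS]expr1 ler_eXn2l // ; move: aK a4; clear; lra.
have {}H : (n - K%:R) * bin_ratio R N K <= 4 * K%:R.
  rewrite -(ler_pM2l K0) mulrA; apply: le_trans H _.
  by rewrite [leRHS](_ : _ = 4 * K%:R ^+ 2); [move: K2n KK; clear; lra|ring].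
have {}H : n * (expR (- (c * L))) < 32 * a.
  have : n * (3 / 5) * (expR (- (c * L)) / 4) <= (n - K%:R) * bin_ratio R N K.
    apply: ler_pM; rewrite ?mulr_ge0 ?divr_ge0 ?expR_ge0 ?(ltW NR) //.
    by move: Ka an a4; clear; lra.
  rewrite [leLHS](_ : _ = n * expR (- (c * L)) * (3 / 20)); last by field.
  by move: H Ka a4; clear; lra.
have e0 : 0 <= n * expR (- (c * L)) by rewrite mulr_ge0 ?expR_ge0 ?(ltW NR).
have : (n * expR (- (c * L))) ^+ 2 < (32 * a) ^+ 2.
  by rewrite ltr_sqr ?nnegrE // mulr_ge0.
rewrite !exprMn a2 -expRM_natl ltNge => /negP; apply.
have -> : 32 ^+ 2 = c3 by rewrite /c3 -natrX.
have -> : 2%:R * - (c * L) = - (2 * c * L) :> R by ring.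
apply: le_trans (_ : c3 * (n * L) <= _).
  rewrite mulrCA ler_piMl ?mulr_ge0 ?(ltW c30) ?(ltW NR) ?(ltW L0) //; move: c2; clear; lra.
by rewrite expr2 -[leRHS]mulrA mulrCA ler_wpM2l ?(ltW NR).
Qed.

(** * Excluding misplaced throws for large [N] *)

Lemma bin_tailE (R : realType) (N k : nat) : (k <= N)%N ->
  bin_tail R N k = (\sum_(k <= s < N) gap_count N s (s - k))%:R / ('C(2 * N, N))%:R.
Proof. by move=> kN; rewrite /bin_tail sum_gap_count. Qed.

Lemma leq_double_uphalf (k : nat) : (k <= 2 * uphalf k.-1 + 1)%N.
Proof. by rewrite uphalf_half; have := odd_double_half k.-1; lia. Qed.

(* The swap inequality forces [j - i] to be at most about [N^(7/8)], and the walk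
   spends too little time at level [k - 1] during so few steps to pay for the throw. *)
Lemma no_misplaced_throw (R : realType) :
  exists N0 : nat, forall N k i j : nat, (N0 <= N)%N ->
    bin_tail R N k <= 1 -> ~ misplaced_throw N k i j.
Proof.
(* For [k^2 = c N ln N] a gap has probability about [N^(-1/2 - c)]. The constant [2/5], weakened to
   [3/8] to absorb rounding, gives the exponent [7/8]. *)
have [|N1 N1P] := @bin_tail_gt1_near R (2 / 5); first by apply/andP; split; lra.
pose c9 := 900%:R : R.
have [N2 N2P] := ln_nat_large (128 * c9 : R).
exists (maxn N1 N2) => N k i j; rewrite geq_max => /andP[N1N N2N] tail_le1.
case=> ij bN k_gt0 ki [s [si ks swap]] win_le.
have [N_gt0 L_large] := N2P N N2N.
have NR : 0 < N%:R :> R by rewrite ltr0n.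
have k_large : 2 / 5 * (N%:R * ln N%:R) < k%:R ^+ 2 :> R.
  by rewrite ltNge; apply/negP => /(N1P _ _ N1N); rewrite ltNge tail_le1.
have c9E : c9 = 900 by [].
have nE : expR (ln N%:R) = N%:R :> R by rewrite lnK ?posrE.
have kN : (k <= N)%N by lia.
have jN : (j < N)%N by lia.
set L := ln N%:R in L_large k_large nE.
have L0 : 0 < L by apply: lt_le_trans L_large; rewrite c9E; lra.
(* In powers of [y = N^(1/8)] the sizes are: gaps at most [2 / y^7], [k <= y^5] and
   [j - i <= y^7 / 10]. The bound [L <= y / 900] absorbs the logarithms. *)
pose y := expR (L / 8).
have y0 : 0 < y := expR_gt0 _.
have y8 : y ^+ 8 = N%:R by rewrite -expRM_natl mulrC divfK.
have Ly : c9 * L <= y.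
  apply: le_trans (expR_ge1Dxn 1 (_ : 0 <= L / 8)); last by rewrite divr_ge0 // ltW.
  have -> : 2`!%:R = 2 :> R by [].
  apply: le_trans (_ : (L / 8) ^+ 2 / 2 <= _); last by clear; lra.
  rewrite [leRHS](_ : _ = L / 128 * L); last by field.
  by rewrite ler_wpM2r ?(ltW L0) // ler_pdivlMr // mulrC.
have L900 : 900 <= L.
  by apply: le_trans L_large; rewrite c9E; clear; lra.
have y900 : 900 <= y.
  have := expR_ge1Dx (L / 8) ; move: Ly; rewrite c9E; move: L900; clear; lra.
have yL : L <= y / 900 by move: Ly; rewrite c9E; clear; lra.
set n := N%:R in NR k_large nE y8.
have n_ge : 900 <= n by rewrite -nE; apply: le_trans (expR_ge1Dx _); move: L900; clear; lra.
have k0 : 0 < k%:R :> R by rewrite ltr0n.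
have nL : 900 * n <= n * L by rewrite mulrC ler_wpM2l ?(ltW NR).
have k60 : 64 <= k%:R :> R.
  rewrite leNgt; apply/negP => klt; suff : k%:R ^+ 2 < 64 * 64 :> R.
    by move: k_large nL n_ge; clear; lra.
  by rewrite expr2; apply: ltr_pM; rewrite ?ler0n.
have k_gt1 : (1 < k)%N by rewrite -(ltr_nat R); move: k60; clear; lra.
pose C := ('C(2 * N, N))%:R : R; have C0 : 0 < C := central_bin_gt0 R N.
pose G : R := 2 / y ^+ 7; have G0 : 0 <= G by rewrite divr_ge0 ?exprn_ge0 ?(ltW y0).
pose h := uphalf k.-1.
have hk : k%:R - 1 <= 2 * h%:R :> R.
  by have := leq_double_uphalf k; rewrite -(ler_nat R) natrD natrM lerBlDr.
have h_large : 3 / 4 * L * (n + 1) <= 8 * h%:R ^+ 2.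
  have -> : 8 * h%:R ^+ 2 = 2 * (2 * h%:R) ^+ 2 :> R by ring.
  have k1 : (k%:R - 1) ^+ 2 <= (2 * h%:R) ^+ 2 :> R.
    by rewrite ler_sqr ?nnegrE // ?mulr_ge0 //; move: k60; clear; lra.
  have kk : 64 * k%:R <= k%:R ^+ 2 :> R by rewrite expr2 ler_wpM2r ?(ltW k0).
  have : (k%:R - 1) ^+ 2 = k%:R ^+ 2 - 2 * k%:R + 1 :> R by ring.
  rewrite [leLHS](_ : _ = 3 / 4 * (n * L) + 3 / 4 * L); last by ring.
  have : 900 * L <= n * L by rewrite ler_wpM2r ?(ltW L0).
  by move: k1 kk k_large L0; clear; lra.
have gap_le x : (i <= x < j + k.-1)%N ->
    (gap_count N x (x.+1 - k))%:R / C <= G.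
  move=> /andP[ix xj]; have -> : (x.+1 - k = x - k.-1)%N by clear -k_gt0; lia.
  have kx : (k.-1 <= x)%N by clear -ki ix; lia.
  have xN : (x < N)%N by clear -xj bN; lia.
  have h_ge : n + 1 <= 8 * h%:R ^+ 2.
    apply: le_trans h_large; rewrite ler_peMl //; move: L900 NR; clear; lra.
  have := gap_count_upper kx xN h_ge; rewrite -/C -/n -/h => bound.
  have g0 : 0 <= (gap_count N x (x - k.-1))%:R / C by rewrite divr_ge0 ?(ltW C0).
  suff : ((gap_count N x (x - k.-1))%:R / C) ^+ 2 <= G ^+ 2 by rewrite ler_sqr ?nnegrE.
  apply: le_trans bound _.
  have -> : G ^+ 2 = 4 / n * expR (- (3 / 4 * L)).
    rewrite expRN; have -> : 3 / 4 * L = 6%:R * (L / 8) by field.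
    by rewrite expRM_natl -/y /G -y8; field; rewrite gt_eqF.
  rewrite ler_wpM2l ?divr_ge0 ?(ltW NR) // ler_expR lerN2 ler_pdivlMr //.
  by move: NR; clear; lra.
pose S := (\sum_(i <= x < j + k.-1) gap_count N x (x.+1 - k))%N.
have S_le : S%:R / C <= (j + k.-1 - i)%:R * G.
  rewrite /S natr_sum mulr_suml; apply: le_trans (_ : \sum_(i <= x < j + k.-1) G <= _).
    by rewrite big_nat [leRHS]big_nat; apply: ler_sum => x; apply: gap_le.
  by rewrite sumr_const_nat mulr_natl.
have r0 := bin_ratio_ge0 R N k.
have r_le := bin_ratio_le R kN.
have n21 : 0 < 2 * n + 1 by move: NR; clear; lra.
have r_small : bin_ratio R N k <= 1 / 8.
  apply: le_trans r_le _; rewrite -/n expRN mul1r lef_pV2 ?posrE ?expR_gt0 //.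
  apply: le_trans (expR_ge1Dx _).
  have : 7 <= 2 * k%:R ^+ 2 / (2 * n + 1).
    by rewrite ler_pdivlMr //; move: k_large nL NR n_ge; clear; lra.
  by move: (_ / _) => x; clear; lra.
(* At position [j + k - 1] the value [j] is won with probability at least [7/8], by reflection and
   [r_small]; at position [i < j] with probability at most [1/2]. The sum must cover the
   difference. *)
have S_ge : 3 / 8 <= S%:R / C.
  have half := win_count_le_half (ltnW ij) jN.
  have anti : (win_count N (j + k.-1) j + win_count N j (j + k.-1) = 'C(2 * N, N))%N.
    exact: win_countC (ltnW bN) jN.
  have jb : (j < j + k.-1)%N by clear -k_gt1; lia.
  have := win_count_le_bin jb bN; have -> : (j + k.-1 - j + 1 = k)%N by clear -k_gt0; lia.
  move: win_le half anti; rewrite -/S => win_le half anti.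
  rewrite -(ler_nat R) => refl.
  have : (2 * 'C(2 * N, N) <= 'C(2 * N, N) + 2 * S + 2 * win_count N j (j + k.-1))%N by clear
    -win_le half anti; lia.
  rewrite -(ler_nat R) natrM natrD natrD !natrM -/C => main.
  rewrite ler_pdivlMr //.
  have : ('C(2 * N, N - k))%:R <= 1 / 8 * C by rewrite -ler_pdivrMr.
  by move: main refl C0; clear; lra.
have S_tail : S%:R / C <= bin_tail R N k.-1.
  rewrite bin_tailE; last by clear -kN; lia.
  rewrite ler_pM2r ?invr_gt0 // ler_nat /S.
  have ki' : (k.-1 <= i)%N by clear -ki; lia.
  have ib : (i <= j + k.-1)%N by clear -ij; lia.
  rewrite [leqRHS](big_cat_nat ki' (leq_trans ib (ltnW bN))) /=.
  rewrite [X in (_ <= _ + X)%N](big_cat_nat ib (ltnW bN)) /=.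
  apply: leq_trans (leq_addl _ _); apply: leq_trans (leq_addr _ _).
  apply: leq_sum_interval => x /andP[ix _].
  by have -> : (x.+1 - k = x - k.-1)%N by clear -k_gt0; lia.
have kn : k%:R <= n by rewrite ler_nat.
(* [S] is part of the tail at [k - 1], which is thus at least [3/8]; the Mills and Gaussian upper
   bounds then keep [k] from being too large. *)
have k_upper : k%:R ^+ 2 <= 3 * (n * L).
  have nr_ge : 3 / 8 <= n * bin_ratio R N k.
    have := bin_tail_pred_le R k_gt0 kN; rewrite -/n => tail.
    have {}tail : k%:R * bin_tail R N k.-1 <= n * bin_ratio R N k.
      have : (n + k%:R) * bin_ratio R N k <= 2 * n * bin_ratio R N k.
        by rewrite ler_wpM2r //; move: kn; clear; lra.
      by move: tail; rewrite -mulrA -[2 * n * _]mulrA; clear; lra.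
    apply: le_trans tail; apply: le_trans (le_trans S_ge S_tail) _.
    by rewrite ler_peMl ?bin_tail_ge0 //; move: k60; clear; lra.
  have : 2 * k%:R ^+ 2 / (2 * n + 1) <= 2 * L.
    rewrite -ler_expR.
    rewrite expRM_natl nE -[leLHS]invrK -expRN.
    have e_ge : 3 / 8 / n <= expR (- (2 * k%:R ^+ 2 / (2 * n + 1))).
      by rewrite ler_pdivrMr // [leRHS]mulrC; apply: le_trans nr_ge _;
        rewrite ler_wpM2l ?(ltW NR).
    rewrite -[leRHS]invrK lef_pV2 ?posrE ?invr_gt0 ?exprn_gt0 ?expR_gt0 //.
    apply: le_trans e_ge; rewrite ler_pdivlMr // expr2 invfM -mulrA mulVf ?gt_eqF // mulr1.
    rewrite -[leLHS]mul1r ler_pdivrMr //; move: n_ge; clear; lra.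
  rewrite ler_pdivrMr // => kL.
  have : 900 * L <= n * L by rewrite ler_wpM2r ?(ltW L0).
  move: kL; rewrite [2 * L * _](_ : _ = 4 * (n * L) + 2 * L); last by ring.
  by move: L0; clear; lra.
have nLy : n * L <= y ^+ 9 / 900.
  by rewrite exprSr -y8 -mulrA ler_wpM2l // exprn_ge0 // ltW.
have y9 : 0 <= y ^+ 9 by rewrite exprn_ge0 ?(ltW y0).
have k_y5 : k%:R <= y ^+ 5.
  have : k%:R ^+ 2 <= (y ^+ 5) ^+ 2.
    rewrite [leRHS](_ : _ = y ^+ 9 * y); last by ring.
    apply: le_trans k_upper _.
    apply: le_trans (_ : y ^+ 9 * 1 <= _); first by move: nLy y9; clear; lra.
    by rewrite ler_wpM2l //; move: y900; clear; lra.
  by rewrite ler_sqr ?nnegrE ?exprn_ge0 ?(ltW y0).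
have ln2n : ln (2 * n) <= 2 * L.
  rewrite -ler_expR lnK ?posrE ?mulr_gt0 //.
  by rewrite expRM_natl nE expr2 ler_wpM2r ?(ltW NR) //; move: n_ge; clear; lra.
have dist : j%:R - i%:R <= y ^+ 7 / 10.
  have sj : (s < j)%N by exact: ltn_trans ij.
  have := @swap_distance R N s (i - k) j ks sj jN swap; rewrite -/n => dist2.
  have ji : 0 <= j%:R - i%:R :> R by rewrite subr_ge0 ler_nat ltnW.
  have lower : (j%:R - i%:R) ^+ 2 <= ((j - s) * (j - s).-1)%:R :> R.
    rewrite -natrB ?(ltnW ij) // -natrX ler_nat expnS expn1.
    by apply: leq_mul; clear -si ij; lia.
  have upper : 4 * n * ((s - (i - k))%:R * ln (2 * n)) <= 4 * n * (y ^+ 5 * (2 * L)).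
    rewrite ler_wpM2l ?mulr_ge0 ?(ltW NR) //.
    apply: ler_pM => //; first by rewrite ln_ge0 //; move: n_ge; clear; lra.
    by apply: le_trans k_y5; rewrite ler_nat; clear -si ki; lia.
  have : (j%:R - i%:R) ^+ 2 <= (y ^+ 7 / 10) ^+ 2.
    apply: le_trans lower (le_trans dist2 (le_trans upper _)).
    rewrite [leLHS](_ : _ = 8 * y ^+ 5 * (n * L)); last by ring.
    apply: le_trans (_ : 8 * y ^+ 5 * (y ^+ 9 / 900) <= _).
      by rewrite ler_wpM2l // mulr_ge0 // exprn_ge0 // ltW.
    rewrite [leLHS](_ : _ = 8 / 900 * y ^+ 14); last by field.
    rewrite [leRHS](_ : _ = 1 / 100 * y ^+ 14); last by field.
    by rewrite ler_wpM2r ?exprn_ge0 ?(ltW y0) //; clear; lra.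
  by rewrite ler_sqr ?nnegrE // divr_ge0 // exprn_ge0 // ltW.
have : (j + k.-1 - i)%:R * G <= 3 / 10.
  have y7 : 0 < y ^+ 7 by rewrite exprn_gt0.
  rewrite /G mulrA ler_pdivrMr //.
  have : (j + k.-1 - i)%:R <= j%:R - i%:R + k%:R :> R.
    rewrite -natrB ?(ltnW ij) // -natrD ler_nat; clear -ij; lia.
  have y57 : 100 * y ^+ 5 <= y ^+ 7.
    rewrite [leRHS](_ : _ = y ^+ 2 * y ^+ 5); last by ring.
    rewrite ler_wpM2r ?exprn_ge0 ?(ltW y0) // expr2.
    by apply: (@sqr_ge _ _ 100); move: y900; clear; lra.
  by move: dist k_y5 y57 y7; clear; lra.
by move: S_le S_ge; clear; lra.
Qed.

(** * Bounds and asymptotics for the optimal number of throws *)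

Lemma kstar_optimal (R : realType) (N : nat) :
  (exists2 k : nat, (k <= N)%N & optimal R (throw N k)) ->
  (kstar R N <= N)%N /\ optimal R (throw N (kstar R N)).
Proof.
case=> k kN k_opt; pose A := [pred k : 'I_N.+1 | optimal R (throw N k)].
have A_gt0 : (0 < #|A|)%N by apply/card_gt0P; exists (Ordinal (kN : (k < N.+1)%N)).
have [k' k'_opt kE] := eq_bigmax_cond (fun i : 'I_N.+1 => val i) A_gt0.
have -> : kstar R N = k' by exact: kE.
by rewrite -ltnS ltn_ord; split.
Qed.

Lemma bin_tail_le1 (R : realType) (N : nat) (pi : 'S_N) : (0 < N)%N ->
  (forall sigma : 'S_N, (score sigma <= score pi)%N) ->
  bin_tail R N #|throwers pi| <= 1.
Proof.
move=> N_gt0 opt; have kN : (#|throwers pi| <= N)%N by rewrite -[leqRHS]card_ord max_card.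
by rewrite bin_tailE // ler_pdivrMr ?central_bin_gt0 // mul1r ler_nat sum_gap_count_le.
Qed.

Lemma optimal_throw_bounds (R : realType) (N k : nat) : (400 < N)%N -> (k <= N)%N ->
  optimal R (throw N k) ->
  bin_tail R N k <= 1 /\ ((0 < k)%N -> 1 <= 2 * bin_tail R N k.-1).
Proof.
move=> N400 kN /optimalP opt; have N2 : (2 < N)%N by apply: leq_trans N400.
have cT : #|throwers (throw N k)| = k.
  by rewrite throwers_throw // card_ord_lt.
split; first by have := @bin_tail_le1 R N _ _ opt; rewrite cT; apply; apply: leq_trans N2.
move=> k_gt0; have := throw_optimal_le N2 k_gt0 kN opt.
rewrite -(ler_nat R) natrM /bin_tail mulrA ler_pdivlMr ?central_bin_gt0 // mul1r.
by [].
Qed.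

Lemma kstar_bounds (R : realType) (N : nat) : (400 < N)%N ->
  (exists2 k : nat, (k <= N)%N & optimal R (throw N k)) ->
  N%:R * ln (N%:R : R) / 4 < (kstar R N)%:R ^+ 2 < N%:R * ln (N%:R : R) / 2.
Proof.
move=> N400 /kstar_optimal[kN k_opt].
have [tail_le1 tail_ge] := @optimal_throw_bounds R N _ N400 kN k_opt.
have lower : N%:R * ln N%:R / 4 < (kstar R N)%:R ^+ 2 :> R.
  by rewrite ltNge; apply/negP => /(@bin_tail_gt1 R N _ N400); rewrite ltNge tail_le1.
rewrite lower ltNge; apply/negP => upper.
have k_gt0 : (0 < kstar R N)%N.
  rewrite lt0n; apply/eqP => k0; move: lower; rewrite k0 expr0n ltNge => /negP; apply.
  by rewrite divr_ge0 // mulr_ge0 // ln_ge0 // ler1n; apply: leq_trans N400.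
have := @bin_tail_lt_half R N _ N400 _ upper; rewrite k_gt0 kN => /(_ isT).
by rewrite ltNge tail_ge.
Qed.

Lemma exists_optimal_throw (R : realType) :
  exists N0 : nat, forall N : nat, (N0 <= N)%N ->
    exists2 k : nat, (k <= N)%N & optimal R (throw N k).
Proof.
have [N0 N0P] := no_misplaced_throw R; exists N0.+1 => N N0N.
case: (@arg_maxnP 'S_N 1%g xpredT (@score N) isT) => pi _ pi_max.
have opt (sigma : 'S_N) : (score sigma <= score pi)%N by apply: pi_max.
have [piE|[i [j mis]]] := optimal_throw_dichotomy opt; last first.
  case: (N0P N _ i j (ltnW N0N) _ mis).
  by apply: bin_tail_le1 => //; apply: leq_trans N0N.
exists #|throwers pi|; first by rewrite -[leqRHS]card_ord max_card.
by apply/optimalP => sigma; rewrite -piE.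
Qed.

Local Open Scope classical_set_scope.

Lemma kstar_asymptotic (R : realType) :
  (fun N : nat => (kstar R N)%:R / Num.sqrt (N%:R * ln (N%:R : R) / 2))
    @ \oo --> (1 : R).
Proof.
have [N1 N1P] := exists_optimal_throw R.
apply/cvgrPdist_le => /= e e0.
(* The cap [1 / 2] keeps [(1 - d)^2 / 2] strictly between 0 and [1 / 2]. *)
pose d := Num.min e (1 / 2); have d0 : 0 < d by rewrite lt_min e0; lra.
have d2 : d <= 1 / 2 by rewrite ge_min lexx orbT.
have [|N2 N2P] := @bin_tail_gt1_near R ((1 - d) ^+ 2 / 2).
  by rewrite expr2; apply/andP; split; nra.
exists (maxn 401 (maxn N1 N2)) => // N /=; rewrite !geq_max => /and3P[N400 N1N N2N].
have ex := N1P N N1N; have /andP[_ upper] := kstar_bounds N400 ex.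
have [kN k_opt] := kstar_optimal ex.
have [tail_le1 _] := @optimal_throw_bounds R N _ N400 kN k_opt.
have lower : (1 - d) ^+ 2 / 2 * (N%:R * ln N%:R) < (kstar R N)%:R ^+ 2 :> R.
  by rewrite ltNge; apply/negP => /(N2P _ _ N2N); rewrite ltNge tail_le1.
set M := N%:R * ln _ / 2 in upper *.
have M0 : 0 < M by apply: le_lt_trans upper; apply: sqr_ge0.
have s0 : 0 < Num.sqrt M by rewrite sqrtr_gt0.
have s2 : Num.sqrt M ^+ 2 = M by rewrite sqr_sqrtr // ltW.
have up : (kstar R N)%:R < Num.sqrt M by rewrite -ltr_sqr ?nnegrE ?(ltW s0) // s2.
have low : (1 - d) * Num.sqrt M < (kstar R N)%:R.
  rewrite -ltr_sqr ?nnegrE ?mulr_ge0 ?(ltW s0) //; last by lra.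
  by rewrite exprMn s2; apply: le_lt_trans lower; rewrite /M mulrA mulrAC.
rewrite ler_norml; apply/andP; split.
  rewrite lerBrDl -lerBrDr opprK ler_pdivrMr //.
  apply: le_trans (ltW up) _; rewrite ler_peMl ?(ltW s0) //; lra.
rewrite lerBlDl -lerBlDr ler_pdivlMr //; apply: le_trans (ltW low).
by rewrite ler_wpM2r ?(ltW s0) // lerD2l lerN2 ge_min lexx.
Qed.

Theorem mainTheorem2 (R : realType) :
  (forall N : nat, (400 < N)%N ->
     (exists2 k : nat, (k <= N)%N & optimal R (throw N k)) ->
     Num.sqrt (N%:R * ln (N%:R : R) / 4) < (kstar R N)%:R /\
     (kstar R N)%:R < Num.sqrt (N%:R * ln (N%:R : R) / 2)) /\
  (exists N0 : nat, forall N : nat, (N0 <= N)%N ->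
     exists2 k : nat, (k <= N)%N & optimal R (throw N k)) /\
  (fun N : nat => (kstar R N)%:R / Num.sqrt (N%:R * ln (N%:R : R) / 2))
    @ \oo --> (1 : R).
Proof.
split; last by split; [exact: exists_optimal_throw|exact: kstar_asymptotic].
move=> N N400 /(kstar_bounds N400)/andP[lower upper].
have L0 : 0 <= N%:R * ln (N%:R : R).
  by rewrite mulr_ge0 // ln_ge0 // ler1n; apply: leq_trans N400.
split; rewrite -ltr_sqr ?nnegrE ?sqrtr_ge0 // sqr_sqrtr ?divr_ge0 //.
Qed.
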